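(* Let $(\Omega,\mathcal B)$ be a measurable space, let $\mu$ be a $\sigma$-finite signed measure on $(\Omega,\mathcal B)$ whose range $\{\mu(A):A\in\mathcal B\}$ is an interval, and let $\nu$ be a $\sigma$-finite signed measure on $(\Omega,\mathcal B)$ satisfying condition $(\mathcal L)$ with respect to $\mu$. Suppose there exist $\epsilon>0$ and $M<\infty$ such that $\left|\frac{\nu(A)}{\mu(A)}\right|<M$ whenever $A$ is an atom of $\mu$ with $\mu(A)<\epsilon$. Then $\nu=\alpha\mu$ for some $\alpha\in\mathbb R$.
   Context: A $\sigma$-finite signed measure on $(\Omega,\mathcal B)$ is a countably additive extended-real-valued set function vanishing on $\emptyset$, taking at most one of the two values $+\infty,-\infty$, whose total variation $|\mu|$ is $\sigma$-finite. An atom of a signed measure $\mu$ is an atom of $|\mu|$, i.e. a set $A\in\mathcal B$ with $|\mu|(A)>0$ such that every measurable subset $B\subset A$ has $|\mu|(B)\in\{0,|\mu|(A)\}$. A signed measure $\nu$ satisfies condition $(\mathcal L)$ with respect to $\mu$ if for all $A,B\in\mathcal B$ with $\mu(A)=\mu(B)\neq\pm\infty$ one has $\nu(A)=\nu(B)\neq\pm\infty$. *)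

(* Defs.v *)
From HB Require Import structures.
From mathcomp Require Import all_boot all_order all_algebra.
From mathcomp Require Import all_classical all_reals all_analysis.
Set Implicit Arguments. Unset Strict Implicit. Unset Printing Implicit Defensive.
Import Order.TTheory GRing.Theory Num.Theory.
Import numFieldNormedType.Exports.
Local Open Scope classical_set_scope.
Local Open Scope ring_scope.
Local Open Scope ereal_scope.

Section signed.
Context {d : measure_display} {T : measurableType d} {R : realType}.
Implicit Types (mu : set T -> \bar R).

Definition is_signed_measure mu : Prop :=
  mu set0 = 0 /\
  ~ ((exists A, measurable A /\ mu A = +oo) /\ (exists B, measurable B /\ mu B = -oo)) /\
  (forall F : nat -> set T, (forall n, measurable (F n)) -> trivIset setT F ->
     (fun n => \sum_(0 <= i < n) mu (F i)) @ \oo --> mu (\bigcup_n F n)).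

Definition total_variation mu (A : set T) : \bar R :=
  ereal_sup [set x | exists (n : nat) (F : nat -> set T),
    (forall i, measurable (F i) /\ F i `<=` A) /\
    (forall i j, (i < n)%N -> (j < n)%N -> i <> j -> F i `&` F j = set0) /\
    x = \sum_(0 <= i < n) `| mu (F i) |].

Definition sigma_finite_signed mu : Prop :=
  is_signed_measure mu /\
  exists F : nat -> set T, (forall n, measurable (F n) /\ total_variation mu (F n) < +oo)
    /\ \bigcup_n F n = setT.

Definition signed_atom mu (A : set T) : Prop :=
  measurable A /\ 0 < total_variation mu A /\
  forall B, measurable B -> B `<=` A ->
    total_variation mu B = 0 \/ total_variation mu B = total_variation mu A.

Definition condL (nu mu : set T -> \bar R) : Prop :=
  forall A B, measurable A -> measurable B -> mu A = mu B -> mu A \is a fin_num ->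
    nu A = nu B /\ nu A \is a fin_num.

Definition range_is_interval mu : Prop :=
  forall x y z : \bar R,
    (exists A, measurable A /\ mu A = x) -> (exists B, measurable B /\ mu B = y) ->
    x <= z -> z <= y -> exists C, measurable C /\ mu C = z.

End signed.

(* Main.v *)
Require Import Defs.
From HB Require Import structures.
From mathcomp Require Import all_boot all_order all_algebra.
From mathcomp Require Import all_classical all_reals all_analysis.
From mathcomp Require Import ring lra.
Import Order.TTheory GRing.Theory Num.Theory.
Import numFieldNormedType.Exports.
Local Open Scope classical_set_scope.
Local Open Scope ring_scope.
Set Implicit Arguments.
Unset Strict Implicit.

(* A Hahn decomposition P, N has a part of finite measure, say N. Exchanging A
   with (A & P) | (N - A) turns mu into m = |mu| and nu into a set function n
   that is real-valued and countably additive on sets of finite measure, and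
   condition (L) becomes n = f(m) for a function f; one has to show that f is
   linear.

   Near 0 there are two cases. If, up to some total mass, any set leaves sets of
   arbitrarily small measure disjoint from it, then f is additive and continuous
   from the left on some [0, c]. Otherwise all sets of measure below some rho are
   unions of atoms e_i, of finite total mass. Let alpha be the supremum of the
   ratios n(e_i) / m(e_i), finite by hypothesis, and h(x) = alpha x - f(x) >= 0.
   Every atom has the measure of a union of smaller ones, so ratios close to
   alpha occur at arbitrarily small atoms; h is nondecreasing by compactness of
   2^nat; and since each set contains or avoids a given atom e, every x is an end
   of an interval of length m(e) on which h grows by h(m(e)). Taking atoms with
   h(m(e)) <= delta m(e) gives h = 0 near 0.

   Finally f is linear everywhere: atoms on which n differs from alpha m can be
   exchanged for one another up to small sets, which is contradictory for those
   of almost minimal measure. *)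

(** * Subsums of a series *)

(** Index sets are boolean sequences, so that they are the points of the compact space
    [cantor_space]; [S n] acts as the multiplicity 0 or 1 of [u n]. *)
Definition wsum {R : realType} (u : nat -> R) (S : nat -> bool) : R :=
  limn (series (fun n => u n *+ S n)).

Section wsum.
Context {R : realType}.
Implicit Types (u v : nat -> R) (S : nat -> bool).

Lemma is_cvg_wsum u S : cvgn (series (fun n => `|u n|)) ->
  cvgn (series (fun n => u n *+ S n)).
Proof.
move=> cu; apply: (@normed_cvg R R); apply: series_le_cvg cu => [n|n|n] //=.
by case: (S n) => //=; rewrite normr0.
Qed.

Lemma wsum_lin u v k S : cvgn (series (fun n => `|u n|)) ->
  cvgn (series (fun n => `|v n|)) ->
  wsum (fun n => k * u n - v n) S = k * wsum u S - wsum v S.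
Proof.
move=> cu cv; rewrite /wsum.
have -> : (fun n => (k * u n - v n) *+ S n) =
    k *: (fun n => u n *+ S n) - (fun n => v n *+ S n).
  by apply/funext => n; rewrite !fctE/= mulrnBl -mulrnAr.
have cku := @is_cvg_seriesZ R _ k (is_cvg_wsum (S:=S) cu).
by rewrite (lim_seriesB cku (is_cvg_wsum (S:=S) cv)) (lim_seriesZ k (is_cvg_wsum (S:=S) cu)).
Qed.

Lemma wsum_ge0 u S : (forall n, 0 <= u n) -> cvgn (series u) -> 0 <= wsum u S.
Proof.
move=> u0 cu.
have cu' : cvgn (series (fun n => `|u n|)).
  by rewrite (_ : (fun n => _) = u)//; apply/funext => n; rewrite ger0_norm.
apply: limr_ge; first exact: is_cvg_wsum.
by apply: nearW => n; apply: sumr_ge0 => i _; exact: mulrn_wge0.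
Qed.

Lemma ler_wsum u v S S' : cvgn (series (fun n => `|u n|)) ->
  cvgn (series (fun n => `|v n|)) ->
  (forall n, u n *+ S n <= v n *+ S' n) -> wsum u S <= wsum v S'.
Proof. by move=> cu cv uv; apply: lim_series_le => //; exact: is_cvg_wsum. Qed.

Lemma wsum0 u : wsum u (fun=> false) = 0.
Proof.
rewrite /wsum (_ : series _ = fun=> 0) ?lim_cst//.
by apply/funext => n; rewrite /series/= big1.
Qed.

Lemma wsum_single u n : wsum u (pred1 n) = u n.
Proof.
apply/cvg_lim => //; apply: cvg_near_cst; exists n.+1 => // k /= nk.
rewrite /series/= big_mkord (bigD1 (Ordinal nk))//= eqxx mulr1n big1 ?addr0// => i.
by rewrite -val_eqE/= => /negbTE ->.
Qed.

Lemma wsumU u S S' : cvgn (series (fun n => `|u n|)) ->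
  (forall n, S n -> S' n -> False) ->
  wsum u (fun n => S n || S' n) = wsum u S + wsum u S'.
Proof.
move=> cu SS'; rewrite /wsum -lim_seriesD; [|exact: is_cvg_wsum..].
congr (limn (series _)); apply/funext => n; rewrite fctE.
by have := SS' n; case: (S n); case: (S' n) => /=;
  rewrite ?mulr1n ?mulr0n ?addr0 ?add0r// => /(_ isT isT).
Qed.

Lemma wsum_add1 u S n : cvgn (series (fun n => `|u n|)) -> ~~ S n ->
  wsum u (fun k => S k || (k == n)) = wsum u S + u n.
Proof.
by move=> cu Sn; rewrite (wsumU cu) ?wsum_single// => k Sk /eqP kn; rewrite -kn Sk in Sn.
Qed.

Lemma wsum_rem1 u S n : cvgn (series (fun n => `|u n|)) -> S n ->
  wsum u (fun k => S k && (k != n)) = wsum u S - u n.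
Proof.
move=> cu Sn; apply/eqP; rewrite -subr_eq opprK -wsum_add1 ?eqxx ?andbF//.
apply/eqP; congr wsum; apply/funext => k; case: eqP => [->|]; rewrite ?andbF ?andbT ?orbT ?orbF//.
Qed.

Lemma cantor_near_agree (S : cantor_space) N :
  \forall S' \near S, forall n, (n < N)%N -> S' n = S n.
Proof.
elim: N => [|N IH]; first by near=> S' => n; rewrite ltn0.
have SN : \forall S' \near S, (S' : cantor_space) N = S N.
  have := @proj_continuous nat (fun=> bool) N S.
  by move=> /(_ [set S N]); apply; rewrite nbhs_principalE.
near=> S' => n; rewrite ltnS leq_eqVlt => /orP[/eqP ->|].
  by near: S'.
by move: n; near: S'.
Unshelve. all: by end_near. Qed.

(** Index sets agreeing below [N] have subsums that differ by at most the tail of the absolute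
    series from [N] on, and agreement below [N] is a neighbourhood condition in the product
    topology. *)
Lemma continuous_wsum u : cvgn (series (fun n => `|u n|)) ->
  continuous (wsum u : cantor_space -> R).
Proof.
move=> cu S; apply/cvgrPdist_le => e e0.
have [N HN] : exists N, limn (series (fun n => `|u n|)) - series (fun n => `|u n|) N <= e.
  have /cvgrPdist_le/(_ e e0)[N _ /(_ N (leqnn N))] := cu.
  move=> HN; exists N; apply: le_trans HN; exact: ler_norm.
near=> S'.
have SS' n : (n < N)%N -> S' n = S n.
  by move: n; near: S'; exact: cantor_near_agree.
have -> : wsum u S - wsum u S' =
    limn (series ((fun n => u n *+ S n) - (fun n => u n *+ S' n))).
  by rewrite lim_seriesB//; exact: is_cvg_wsum.
set w := (_ - _ : nat -> R).
have wu n : `|w n| <= `|u n|.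
  rewrite /w !fctE; case: (S n); case: (S' n); rewrite /= ?mulr0n ?mulr1n ?subrr ?normr0 ?subr0//.
  by rewrite sub0r normrN.
have cw : cvgn [normed series w].
  by apply: series_le_cvg cu => [n|n|n] /=.
apply: le_trans (lim_series_norm cw) _; apply: le_trans HN.
rewrite lerBrDr.
have -> : limn [normed series w] + series (fun n => `|u n|) N =
  limn (fun k => series (fun n => `|w n|) k + series (fun n => `|u n|) N).
  by rewrite limD ?lim_cst//; exact: cvg_cst.
apply: ler_lim => //; first by apply: is_cvgD => //; exact: is_cvg_cst.
near=> k.
have Nk : (N <= k)%N by near: k; exists N.
rewrite /series/= (big_cat_nat (leq0n N) Nk)//= [X in X + _ + _]big1_seq ?add0r.
  rewrite addrC [leRHS](big_cat_nat (leq0n N) Nk)//= lerD2l.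
  by apply: ler_sum => i _; exact: wu.
move=> i; rewrite /= mem_index_iota => /andP[_ iN].
by rewrite /w !fctE SS'// subrr normr0.
Unshelve. all: by end_near. Qed.

(** Compactness passes to the image. A value approximated by subsums over a closed family of index
    sets is thus itself a subsum over that family. *)
Lemma closed_wsum_image u (C : set cantor_space) : cvgn (series (fun n => `|u n|)) ->
  closed C -> closed [set wsum u S | S in C].
Proof.
move=> cu cC; apply: compact_closed; first exact: Rhausdorff.
apply: continuous_compact; first by apply: continuous_subspaceT; exact: continuous_wsum.
by apply: subclosed_compact cantor_space_compact _.
Qed.

Lemma closed_cantor_coord n (v : bool) : closed [set S : cantor_space | S n = v].
Proof.
have : closed ((fun S : cantor_space => S n) @^-1` [set v]).
  apply: preimage_closed; first by move=> S _; exact: (@proj_continuous nat (fun=> bool) n S).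
  by apply: discrete_closed.
by [].
Qed.

End wsum.

(** * Nonnegative series whose subsums fill an interval *)

Section subsums.
Context {R : realType} (a : nat -> R) (rho : R).
Hypothesis a_ge0 : forall n, 0 <= a n.
Hypothesis cvg_a : cvgn (series a).
Hypothesis rangea : forall x : R, 0 <= x < rho -> exists S : nat -> bool, wsum a S = x.

Lemma cvg_norm_a : cvgn (series (fun n => `|a n|)).
Proof. by rewrite (_ : (fun n => _) = a)//; apply/funext => n; rewrite ger0_norm. Qed.
Let ca := cvg_norm_a.

Lemma le_wsum1 (S : nat -> bool) n : S n -> a n <= wsum a S.
Proof.
move=> Sn; rewrite -(wsum_single a n); apply: ler_wsum => // k /=.
by case: eqP => [->|_]; rewrite ?Sn// mulrn_wge0.
Qed.

Lemma small_tail eta : 0 < eta -> exists N, forall n, (N <= n)%N -> a n < eta.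
Proof.
move=> eta0; have /cvgrPdist_lt/(_ eta eta0)[N _ HN] := cvg_series_cvg_0 cvg_a.
exists N => n Nn; have := HN n Nn.
by rewrite /= sub0r normrN ger0_norm.
Qed.

(* The subsums of the terms below [a n] fill [0, a n) and form a closed set. *)
Lemma term_eq_wsum_smaller n : 0 < a n < rho ->
  exists S, wsum a S = a n /\ forall k, S k -> a k < a n.
Proof.
move=> /andP[an0 anr].
pose C : set cantor_space := \bigcap_(k in [set k | a n <= a k]) [set S | S k = false].
have cC : closed C by apply: closed_bigI => k _; exact: closed_cantor_coord.
have : closure [set wsum a S | S in C] (a n).
  move=> B /nbhs_ballP[e /= e0 eB].
  (* A value in [[0, a n)] within [e / 2] of [a n]: an index set representing it cannot use a term
     of size at least [a n]. *)
  pose x := Num.max 0 (a n - e / 2).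
  have x0 : 0 <= x by rewrite le_max lexx.
  have xa : x < a n by rewrite /x gt_max an0/=; lra.
  have [|S Sx] := rangea (x := x); first by rewrite x0/= (lt_trans xa).
  exists x; split.
    exists S => // k /= ank; apply/negbTE/negP => /le_wsum1; rewrite Sx; lra.
  apply: eB; rewrite /ball/=.
  have : a n - e / 2 <= x by rewrite le_max lexx orbT.
  by move=> xe; rewrite ger0_norm; lra.
move=> /(closed_wsum_image ca cC)[S CS San]; exists S; split => // k Sk.
rewrite ltNge; apply/negP => ank; have := CS k ank.
by rewrite /= Sk.
Qed.

(** * Monotonicity and growth of a function given by subsums *)

Section monotone.
Context (c : nat -> R) (h : R -> R).
Hypothesis c_ge0 : forall n, 0 <= c n.
Hypothesis cvg_c : cvgn (series (fun n => `|c n|)).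
Hypothesis hE : forall S, h (wsum a S) = wsum c S.

(** The index sets on which [wsum c] is at distance at least [e] from [h x] have a closed image
    under [wsum a], and this image misses [x]. *)
Lemma subsum_continuous x e : 0 < e ->
  (exists S, wsum a S = x) ->
  \forall y \near x, 0 <= y < rho -> `|h x - h y| < e.
Proof.
move=> e0 [S Sx].
pose C : set cantor_space := [set S | e <= `|h x - wsum c S|].
have cC : closed C.
  have : closed ((fun S : cantor_space => `|h x - wsum c S|) @^-1` [set y | e <= y]).
    apply: preimage_closed; last exact: closed_ge.
    move=> S' _; apply: cvg_norm; apply: cvgB; first exact: cvg_cst.
    exact: continuous_wsum.
  by [].
have nCx : ~ [set wsum a S | S in C] x.
  move=> [S' CS' S'x]; have := CS'; rewrite /C/= -hE S'x subrr normr0; lra.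
have oC : open (~` [set wsum a S | S in C]).
  by rewrite openC; exact: closed_wsum_image.
near=> y => yr; rewrite ltNge; apply/negP => ehy.
have [S' S'y] := rangea yr.
have : (~` [set wsum a S | S in C]) y by near: y; exact: open_nbhs_nbhs.
by apply; exists S' => //; rewrite /C/= -hE S'y.
Unshelve. all: by end_near. Qed.

(** If [h y < h x], let [z0] be the last point of [[x, y]] with [h x <= h z0]. An index set
    representing [z0] contains all late nonzero terms, as adding a missing one would give a later
    such point. Hence, among index sets with a fixed initial pattern, [z0] is either the maximal
    subsum or at positive distance from all subsums, and points just to the right of [z0] have no
    representation. *)
Lemma subsum_nondecreasing x y : 0 <= x -> x <= y -> y < rho -> h x <= h y.
Proof.
move=> x0; rewrite le_eqVlt => /predU1P[->//|xy] yr; rewrite leNgt; apply/negP => hyx.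
pose E : set R := [set z | x <= z <= y /\ h x <= h z].
have Ex : E x by split; rewrite ?lexx ?ltW.
have supE : has_sup E by split; [exists x | exists y => z [/andP[]]].
pose z0 := sup E.
have xz0 : x <= z0 by apply: ub_le_sup => //; exact: (proj2 supE).
have z0y : z0 <= y by apply: ge_sup; [exists x|move=> z [/andP[]]].
have z0r : 0 <= z0 < rho by rewrite (le_trans x0 xz0)/= (le_lt_trans z0y).
have hz0 : h x <= h z0.
  rewrite leNgt; apply/negP => hlt.
  have := @subsum_continuous z0 (h x - h z0) _ (rangea z0r).
  rewrite subr_gt0 => /(_ hlt) /nbhs_ballP[e /= e0 He].
  have [z Ez ez] := sup_adherent e0 supE.
  have zz0 : z <= z0 by apply: ub_le_sup => //; exact: (proj2 supE).
  case: Ez => /andP[xz zy] hz.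
  have := He z; rewrite /ball/= => /(_ _ _).
  have -> : `|z0 - z| < e by rewrite ger0_norm ?subr_ge0// ltrBlDl -ltrBlDr.
  move=> /(_ isT); rewrite (le_trans x0 xz) (le_lt_trans zy yr) => /(_ isT).
  by rewrite ltr_norml => /andP[]; lra.
have lt_z0y : z0 < y.
  by rewrite lt_neqAle z0y andbT; apply/eqP => z0E; move: hz0; rewrite z0E; lra.
have gt_z0 z : z0 < z -> z <= y -> h z < h x.
  move=> z0z zy; rewrite ltNge; apply/negP => hz.
  have : z <= z0.
    apply: ub_le_sup; first exact: (proj2 supE).
    by split => //; rewrite zy andbT; lra.
  by lra.
(* Terms from [N] on are so small that adding one of them to [z0] does not overshoot [y]. *)
have [N HN] := small_tail (eta := y - z0) ltac:(lra).
have full S n : wsum a S = z0 -> (N <= n)%N -> 0 < a n -> S n.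
  move=> Sz0 Nn an0; apply/negPn/negP => Sn.
  have /= := wsum_add1 ca Sn; have /= := wsum_add1 cvg_c Sn.
  rewrite -!hE => hS aS; move: hS; rewrite aS Sz0.
  have := gt_z0 (z0 + a n); rewrite ltrDl an0 => /(_ isT).
  have -> : z0 + a n <= y by have := HN n Nn; lra.
  by move=> /(_ isT); have := c_ge0 n; lra.
(* There are finitely many patterns [p] of the first [N] indices, so the neighbourhoods of [z0]
   found for each of them can be intersected. *)
pose C (p : {ffun 'I_N -> bool}) : set cantor_space :=
  \bigcap_(k in [set: 'I_N]) [set S | S k = p k].
have cC p : closed (C p) by apply: closed_bigI => k _; exact: closed_cantor_coord.
have : \forall z \near z0, forall p, [set wsum a S | S in C p] z -> z <= z0.
  apply: (@filter_forall R {ffun 'I_N -> bool}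
    (fun p => [set z | [set wsum a S | S in C p] z -> z <= z0]) (nbhs z0) _) => p.
  have [[S CS Sz0]|nz0] := pselect ([set wsum a S | S in C p] z0).
    apply: nearW => _ [S' CS' <-]; rewrite -Sz0; apply: ler_wsum => // k.
    have [kN|Nk] := ltnP k N.
      by rewrite (CS (Ordinal kN) I) -(CS' (Ordinal kN) I).
    have := a_ge0 k; rewrite le_eqVlt => /predU1P[<-|ak0].
      by rewrite !mul0rn.
    by rewrite (full S k)//; case: (S' k) => //=; exact: a_ge0.
  have oC : open (~` [set wsum a S | S in C p]).
    by rewrite openC; exact: closed_wsum_image.
  near=> z => Cz; exfalso; move: Cz; near: z.
  exact: (open_nbhs_nbhs (conj oC nz0)).
move=> /nbhs_ballP[e /= e0 He].
pose z := z0 + Num.min (e / 2) (y - z0).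
have zm : 0 < Num.min (e / 2) (y - z0) by rewrite lt_min; apply/andP; split; lra.
have zy : z <= y.
  have : Num.min (e / 2) (y - z0) <= y - z0 by rewrite ge_min lexx orbT.
  by rewrite /z; lra.
have [|S Sz] := rangea (x := z); first by rewrite (le_lt_trans zy yr) andbT /z; lra.
have : z <= z0.
  apply: (He z _ [ffun k : 'I_N => S k]).
    rewrite /ball/= /z opprD addrA subrr sub0r normrN gtr0_norm//.
    have : Num.min (e / 2) (y - z0) <= e / 2 by rewrite ge_min lexx.
    by lra.
  by exists S => // k _ /=; rewrite ffunE.
by rewrite /z; lra.
Unshelve. all: by end_near. Qed.

Lemma wsum_has (S : nat -> bool) n : S n -> h (wsum a S - a n) = h (wsum a S) - c n.
Proof.
by move=> Sn; rewrite -(wsum_rem1 ca Sn) !hE wsum_rem1.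
Qed.

Lemma wsum_hasn (S : nat -> bool) n : S n = false -> h (wsum a S + a n) = h (wsum a S) + c n.
Proof.
by move=> /negbT Sn; rewrite -(wsum_add1 ca Sn) !hE wsum_add1.
Qed.

(* Every point is an end of an interval of length [a n] on which [h] grows by
   [c n]; by connectedness, two such intervals around a common point cover
   [p, p + a n]. *)
Lemma subsum_window n p : 0 <= p -> p + 2 * a n < rho -> h (p + a n) <= h p + 2 * c n.
Proof.
move=> p0 pr; have an0 := a_ge0 n; have cn0 := c_ge0 n.
pose I v := [set wsum a S | S in [set S : cantor_space | S n = v]].
have cI v : closed (I v) by apply: closed_wsum_image => //; exact: closed_cantor_coord.
have IP x : 0 <= x < rho -> I true x \/ I false x.
  move=> /rangea[S <-]; case E : (S n); [left|right]; by exists S.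
have [|[S Sn Sx]|Ir] := IP (p + a n); first by apply/andP; split; lra.
  have := wsum_has Sn; rewrite Sx addrK => ->; lra.
have [[z [zs [[S Sn Sz] [S' S'n S'z]]]]|nz] := pselect (exists z,
    (p <= z <= p + a n) /\ I true z /\ I false z).
  (* From a common point [z] one representation allows a step to the right and the other a step to
     the left; [p + a n <= z + a n] and [z - a n <= p] are then compared by monotonicity. *)
  move: zs => /andP[pz zp].
  have := wsum_has Sn; have := wsum_hasn S'n; have := le_wsum1 Sn; rewrite Sz S'z => az h1 h2.
  have : h (p + a n) <= h (z + a n) by apply: subsum_nondecreasing; lra.
  have : h (z - a n) <= h p by apply: subsum_nondecreasing; lra.
  by lra.
(* Without a common point, the part of [[p, p + a n]] in [I false] is relatively open and closed and
   contains [p + a n], hence also [p]. *)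
have [S Sn Sx] : I false p.
  have := @segment_connected R p (p + a n) (`[p, p + a n] `&` I false).
  move=> H; suff : (`[p, p + a n] `&` I false) p by case.
  rewrite H; first by rewrite /= in_itv/= lexx/=; lra.
  - by exists (p + a n); split => //; rewrite /= in_itv/= lexx andbT; lra.
  - exists (~` (I true)); first by rewrite openC.
    apply/seteqP; split => x [xs Ix]; split => //.
      by move=> Ix'; apply: nz; exists x; split => //; move: xs; rewrite /= in_itv.
    move: xs; rewrite /= in_itv/= => xs.
    by have [||//] := IP x; first by apply/andP; split; lra.
  - by exists (I false).
by have := wsum_hasn Sn; rewrite Sx => ->; lra.
Qed.

(** Consecutive windows start from [h 0 = 0]; the last one needs a further [a n] of room below
    [rho]. *)
Lemma subsum_multiple n k : k.+1%:R * a n < rho -> h (k%:R * a n) <= 2 * k%:R * c n.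
Proof.
have an0 := a_ge0 n; elim: k => [_|k IH kr].
  by have := hE (fun=> false); rewrite !wsum0 mul0r mulr0 mul0r => ->.
have := subsum_window (n := n) (p := k%:R * a n).
move: kr; rewrite -!natr1 => kr.
have k0 : 0 <= k%:R :> R by [].
have -> : (k%:R + 1) * a n = k%:R * a n + a n by ring.
move=> /(_ (mulr_ge0 k0 an0)) /(_ ltac:(lra)).
by have := IH ltac:(rewrite -natr1; lra); lra.
Qed.

Lemma subsum_eq0 : (forall delta eta : R, 0 < delta -> 0 < eta ->
    exists n, 0 < a n < eta /\ c n <= delta * a n) ->
  forall x, 0 <= x -> x <= rho / 2 -> 0 < rho -> h x <= 0.
Proof.
move=> small x x0 xr r0; apply/ler_addgt0Pl => e e0; rewrite addr0.
(* With [a n < rho / 4], rounding [x] up to [k%:R * a n] leaves room for one more term below [rho];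
   the ratio [e / (2 * rho)] turns the bound [2 * k%:R * c n] into at most [e]. *)
have [n [/andP[an0 anr] cn]] := small (e / (2 * rho)) (rho / 4) ltac:(apply: divr_gt0; lra) ltac:(lra).
set k := (Num.truncn (x / a n)).+1.
have /andP[k1 k2] : (k%:R - 1) * a n <= x < k%:R * a n.
  have := @truncn_itv R (x / a n) ltac:(apply: divr_ge0; lra).
  rewrite ler_pdivlMr// ltr_pdivrMr// /k => /andP[k1 ->].
  by rewrite -natr1 addrK k1.
have : h x <= h (k%:R * a n) by apply: subsum_nondecreasing => //; lra.
have := @subsum_multiple n k ltac:(rewrite -natr1; lra).
have : 2 * k%:R * c n <= e; last by lra.
have k0 : 0 <= 2 * k%:R :> R by rewrite mulr_ge0.
apply: (le_trans (ler_wpM2l k0 cn)).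
have -> : 2 * k%:R * (e / (2 * rho) * a n) = (e / rho) * (k%:R * a n) by field; lra.
apply: (@le_trans _ _ (e / rho * rho)); last by rewrite divfK//; lra.
by apply: ler_wpM2l; [apply: divr_ge0; lra | lra].
Qed.

End monotone.

(** * Proportionality of two series through their extremal ratio *)

Context (b : nat -> R) (M : R).
Hypothesis rho_gt0 : 0 < rho.
Hypothesis a_lt : forall n, a n < rho.
Hypothesis b_le : forall n, `|b n| <= M * a n.
Hypothesis wsum_ab : forall S S', wsum a S = wsum a S' -> wsum b S = wsum b S'.

Lemma cvg_norm_b : cvgn (series (fun n => `|b n|)).
Proof.
apply: (@series_le_cvg _ _ (M *: a)) => // [n|].
  exact: le_trans (b_le n).
exact: is_cvg_seriesZ.
Qed.
Let cb := cvg_norm_b.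

Lemma cvg_norm_comb alpha : cvgn (series (fun n => `|alpha * a n - b n|)).
Proof.
have le n : `|alpha * a n - b n| <= (`|alpha| + M) * a n.
  by apply: le_trans (ler_normB _ _) _; rewrite normrM (ger0_norm (a_ge0 n)) mulrDl lerD2l.
apply: (@series_le_cvg _ _ (fun n => (`|alpha| + M) * a n)) => // [n|].
  exact: le_trans (le n).
exact: (@is_cvg_seriesZ R a (`|alpha| + M) cvg_a).
Qed.

(** The supremum of the ratios [b n / a n] is approached by arbitrarily small terms: a term of large
    ratio is a subsum of smaller terms, and one of these must have a large ratio too. *)
Lemma extremal_ratio : exists alpha, (forall n, b n <= alpha * a n) /\
  forall delta eta : R, 0 < delta -> 0 < eta ->
    exists n, 0 < a n < eta /\ alpha * a n - b n <= delta * a n.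
Proof.
pose E : set R := [set b n / a n | n in [set n | 0 < a n]].
have bM n : b n <= M * a n by apply: le_trans (b_le n); exact: ler_norm.
have [n0 an0] : exists n, 0 < a n.
  have [|S Sx] := rangea (x := rho / 2); first by rewrite divr_ge0 ?ltW//= ltr_pdivrMr// ltr_pMr// ltr1n.
  apply: contrapT => /forallNP an0.
  have : wsum a S <= 0; last by rewrite Sx leNgt divr_gt0.
  rewrite -(wsum0 a); apply: ler_wsum => // n; rewrite mulr0n.
  by have /negP := an0 n; rewrite -leNgt => /mulrn_wle0.
have supE : has_sup E.
  split; first by exists (b n0 / a n0); exists n0.
  by exists M => _ [n /= an <-]; rewrite ler_pdivrMr.
pose alpha := sup E; exists alpha.
have balpha n : b n <= alpha * a n.
  have := a_ge0 n; rewrite le_eqVlt => /predU1P[an|an].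
    by have := bM n; rewrite -an !mulr0.
  rewrite -ler_pdivrMr//; apply: ub_le_sup; first exact: (proj2 supE).
  by exists n.
split => // delta eta delta0 eta0; apply: contrapT => /forallNP nsmall.
pose G n := (0 < a n) && (alpha * a n - b n < delta * a n).
have [n1 Gn1] : exists n, G n.
  have [_ [n /= an <-]] := sup_adherent delta0 supE.
  rewrite ltr_pdivlMr// => H; exists n; rewrite /G an/=; move: H.
  by rewrite -/alpha; lra.
have [N HN] := small_tail eta0.
have GN n : G n -> (n < N)%N.
  move=> /andP[an Gn]; rewrite ltnNge; apply/negP => /HN anN.
  by apply: (nsmall n); split; [apply/andP|exact: ltW].
(* The smallest term with ratio above [alpha - delta]; the strictly smaller terms that sum to it
   have ratio at most [alpha - delta], and so would their sum. *)
have [i Gi imin] := @arg_minP _ R 'I_N (Ordinal (GN _ Gn1)) (fun i => G i) (fun i => a i) Gn1.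
have /andP[ai0 Gi2] := Gi.
have [S [Sai Slt]] := term_eq_wsum_smaller (n := i) ltac:(by rewrite ai0 a_lt).
have := @wsum_ab S (pred1 (i : nat)); rewrite !wsum_single => /(_ Sai) bS.
have : wsum (fun n => (alpha - delta) * a n - b n) (fun=> false) <=
    wsum (fun n => (alpha - delta) * a n - b n) S.
  apply: ler_wsum => [||n]; [exact: cvg_norm_comb..|].
  rewrite mulr0n; case E1 : (S n) => //=; rewrite mulr1n.
  have := a_ge0 n; rewrite le_eqVlt => /predU1P[an|an].
    by have := b_le n; rewrite -an !mulr0 normr_le0 => /eqP ->; rewrite subr0.
  rewrite leNgt; apply/negP => Gn.
  have Gn' : G n by rewrite /G an/=; lra.
  have := imin (Ordinal (GN _ Gn')) Gn'; rewrite /= leNgt => /negP; apply.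
  exact: Slt.
by rewrite wsum0 wsum_lin// bS Sai; lra.
Qed.

Theorem subsum_linear : exists alpha, forall S, wsum a S <= rho / 2 ->
  wsum b S = alpha * wsum a S.
Proof.
have [alpha [balpha small]] := extremal_ratio.
pose c n := alpha * a n - b n; exists alpha => S Sr.
have cc : cvgn (series (fun n => `|c n|)).
  exact: cvg_norm_comb.
(* Equal subsums of [a] give equal subsums of [b], hence of [c], so the choice of a representing set
   is immaterial; the empty set is the default off the range. *)
pose h x := wsum c (xget (fun=> false) [set S | wsum a S = x]).
have cE S' : wsum c S' = alpha * wsum a S' - wsum b S' by rewrite wsum_lin.
have hE S' : h (wsum a S') = wsum c S'.
  rewrite /h; case: xgetP => [S1 _ /= S1E|/(_ S')/(_ erefl)//].
  by rewrite !cE S1E (wsum_ab S1E).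
have c0 n : 0 <= c n by rewrite /c subr_ge0.
have S0 : 0 <= wsum a S by exact: wsum_ge0.
have := subsum_eq0 c0 cc hE small S0 Sr rho_gt0.
have : 0 <= wsum c S.
  apply: wsum_ge0 => //.
  by move: cc; rewrite (_ : (fun n => _) = c)//; apply/funext => n; rewrite ger0_norm.
by rewrite hE cE; lra.
Qed.

End subsums.

(** * Sets of finite measure *)

Section finite_part.
Context {d : measure_display} {T : measurableType d} {R : realType}
  (m : {measure set T -> \bar R}).
Implicit Types (A B C V W X Y Z : set T) (q : set T -> R).

Definition mfin A := measurable A /\ (m A < +oo)%E.
Definition mval A : R := fine (m A).

(** Since [q] is real-valued, additivity is asked only for unions of finite measure. The notion
    covers both [mval] and the function obtained from [nu]. *)
Definition fin_sigma_additive q := forall F : nat -> set T,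
  (forall i, measurable (F i)) -> trivIset setT F -> (m (\bigcup_i F i) < +oo)%E ->
  series (fun i => q (F i)) @ \oo --> q (\bigcup_i F i).

Definition matom A := [/\ mfin A, 0 < mval A &
  forall B, measurable B -> B `<=` A -> mval B = 0 \/ mval B = mval A].

Lemma mfin_fin_num A : mfin A -> m A \is a fin_num.
Proof. by move=> [mA fA]; rewrite ge0_fin_numE. Qed.

Lemma mvalE A : mfin A -> m A = (mval A)%:E.
Proof. by move=> /mfin_fin_num fA; rewrite fineK. Qed.

Lemma mfinS A B : mfin B -> measurable A -> A `<=` B -> mfin A.
Proof.
move=> [mB fB] mA AB; split => //; apply: le_lt_trans fB.
by apply: le_measure; rewrite ?inE.
Qed.

Lemma mfin0 : mfin set0. Proof. by split => //; rewrite measure0. Qed.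

Lemma mfinU A B : mfin A -> mfin B -> mfin (A `|` B).
Proof.
move=> [mA fA] [mB fB]; split; first exact: measurableU.
apply: le_lt_trans (measureU2 _ mA mB) _.
by rewrite lte_add_pinfty.
Qed.

Lemma mfinD A B : mfin A -> measurable B -> mfin (A `\` B).
Proof. by move=> fA mB; have [mA _] := fA; apply: mfinS fA _ _; [by apply: measurableD|]. Qed.

Lemma mfinI A B : mfin A -> measurable B -> mfin (A `&` B).
Proof. by move=> fA mB; have [mA _] := fA; apply: mfinS fA _ _; [by apply: measurableI|]. Qed.

Lemma mval_ge0 A : 0 <= mval A. Proof. exact: fine_ge0. Qed.

Lemma mval0 : mval set0 = 0. Proof. by rewrite /mval measure0. Qed.

Lemma le_mval A B : mfin B -> measurable A -> A `<=` B -> mval A <= mval B.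
Proof.
move=> fB mA AB; have fA := mfinS fB mA AB.
by rewrite -lee_fin -!mvalE//; apply: le_measure; rewrite ?inE//; case: fB.
Qed.

Lemma mval_sigma : fin_sigma_additive mval.
Proof.
move=> F mF tF fF.
have mUF : measurable (\bigcup_i F i) by exact: bigcup_measurable.
have fFi i : mfin (F i) by apply: mfinS (conj mUF fF) _ _ => //; exact: bigcup_sup.
have : (fun k => (\sum_(0 <= i < k) m (F i))%E) @ \oo --> (mval (\bigcup_i F i))%:E.
  by rewrite -mvalE//; exact: measure_sigma_additive.
move=> /fine_cvg.
apply: cvg_trans; apply: near_eq_cvg; apply: nearW => k /=.
by rewrite /series/= (eq_bigr (fun i => (mval (F i))%:E)) ?sumEFin// => i _; rewrite mvalE.
Qed.

Section additive.
Context (q : set T -> R).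
Hypothesis q_sigma : fin_sigma_additive q.

Lemma fin_additive0 : q set0 = 0.
Proof.
have := @q_sigma (fun=> set0) (fun=> measurable0) (@trivIset_set0 _ _ _).
rewrite bigcup0// measure0 => /(_ (ltry _)) /cvgP /cvg_series_cvg_0 q0.
have : (fun _ : nat => q set0) @ \oo --> q set0 by exact: cvg_cst.
by move/(cvg_unique _) => /(_ (@Rhausdorff _) _ q0).
Qed.

Lemma fin_additiveU A B : mfin A -> mfin B -> A `&` B = set0 ->
  q (A `|` B) = q A + q B.
Proof.
move=> fA fB AB0; have fAB := mfinU fA fB.
have := q_sigma (F := bigcup2 A B).
rewrite bigcup2E => /(_ _ _ (proj2 fAB)) H.
have {}H : series (fun i => q (bigcup2 A B i)) @ \oo --> q (A `|` B).
  apply: H; last by rewrite -trivIset_bigcup2.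
  by move=> [|[|i]]/=; rewrite /bigcup2/=; [case: fA|case: fB|exact: measurable0].
apply: (cvg_unique (@Rhausdorff R) H); apply: cvg_near_cst.
exists 2%N => // -[|[|k]]// _; rewrite /series/= !big_nat_recl//= big1 ?addr0// => i _.
exact: fin_additive0.
Qed.

Lemma fin_additiveD A B : mfin B -> measurable A -> A `<=` B -> q (B `\` A) = q B - q A.
Proof.
move=> fB mA AB; apply/eqP; rewrite eq_sym subr_eq addrC -fin_additiveU; last 3 first.
- exact: mfinS fB mA AB.
- exact: mfinD.
- by rewrite setDE setICA setICr setI0.
by rewrite setDUK.
Qed.

Lemma fin_additiveID A B : mfin A -> measurable B -> q A = q (A `&` B) + q (A `\` B).
Proof.
move=> fA mB; rewrite -fin_additiveU; [|exact: mfinI|exact: mfinD|].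
  by rewrite setUIDK.
by rewrite setDE setIACA setICr setI0.
Qed.

Lemma fin_cvg_nondecreasing F : (forall i, measurable (F i)) -> nondecreasing_seq F ->
  (m (\bigcup_i F i) < +oo)%E -> (fun i => q (F i)) @ \oo --> q (\bigcup_i F i).
Proof.
move=> mF ndF fF.
have mUF : measurable (\bigcup_i F i) by exact: bigcup_measurable.
have fFi i : mfin (F i) by apply: mfinS (conj mUF fF) _ _ => //; exact: bigcup_sup.
have mD i : measurable (seqD F i) by case: i => [|i] /=; [|apply: measurableD].
have := q_sigma mD (trivIset_seqD ndF).
rewrite eq_bigcup_seqD => /(_ fF) H.
rewrite -(cvg_shiftS (series _)) in H.
have E k : \sum_(0 <= i < k.+1) q (seqD F i) = q (F k).
  elim: k => [|k IH]; first by rewrite big_nat1.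
  rewrite big_nat_recr//= IH fin_additiveD//; last exact/subsetPset/ndF.
  by rewrite addrC subrK.
by apply: cvg_trans H; apply: near_eq_cvg; apply: nearW => k; rewrite /series/= E.
Qed.

End additive.

Lemma mfin_bigcup_bounded F K : (forall i, mfin (F i)) -> nondecreasing_seq F ->
  (forall i, mval (F i) <= K) -> mfin (\bigcup_i F i) /\ mval (\bigcup_i F i) <= K.
Proof.
move=> fF ndF FK.
have mUF : measurable (\bigcup_i F i) by apply: bigcup_measurable => i _; case: (fF i).
have : (m (\bigcup_i F i) <= K%:E)%E.
  have H : m \o F @ \oo --> m (\bigcup_i F i).
    by apply: nondecreasing_cvg_mu => // i; case: (fF i).
  rewrite -(cvg_lim _ H)//; apply: lime_le; first by apply/cvg_ex; eexists; exact: H.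
  by apply: nearW => i /=; rewrite mvalE// lee_fin.
move=> H; have fU : mfin (\bigcup_i F i) by split => //; exact: le_lt_trans H (ltry _).
by split => //; rewrite -lee_fin -mvalE.
Qed.

(* Greedy exhaustion: at each stage add a candidate of at least half the largest
   available measure. *)
Lemma exhaustion (Q : set T -> set T -> Prop) A0 (K : R) : mfin A0 -> mval A0 <= K ->
  (forall A V, mfin A -> Q A V -> [/\ mfin V, A `&` V = set0 & mval (A `|` V) <= K]) ->
  (forall A A' V, mfin A -> mfin A' -> A `<=` A' -> Q A' V -> Q A V) ->
  exists F V : nat -> set T,
    [/\ F 0%N = A0, forall i, F i.+1 = F i `|` V i,
        forall i, mfin (F i) /\ mfin (V i) /\ F i `&` V i = set0 /\
          (V i = set0 \/ Q (F i) (V i)),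
        mfin (\bigcup_i F i) /\ mval (\bigcup_i F i) <= K &
        forall W, Q (\bigcup_i F i) W -> mval W = 0].
Proof.
move=> fA0 A0K QV Qanti.
(* The supremum may not be attained, hence the factor 2. The premise stands under the existential so
   that choice gives a total step function, with default [set0]. *)
have pick A : exists V, mfin A -> [/\ mfin V, V = set0 \/ Q A V &
    forall W, Q A W -> mval W <= 2 * mval V].
  have [fA|nfA] := pselect (mfin A); last by exists set0.
  pose E : set R := [set mval V | V in Q A].
  have [[V0 QV0]|nQ] := pselect (exists V, Q A V); last first.
    exists set0 => _; split; [exact: mfin0|by left|] => W QW.
    by exfalso; apply: nQ; exists W.
  have supE : has_sup E.
    split; first by exists (mval V0); exists V0.
    exists K => _ [V QAV <-]; have [fV AV VK] := QV _ _ fA QAV.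
    by apply: le_trans VK; apply: le_mval; [exact: mfinU|case: fV|exact: subsetUr].
  have supP W : Q A W -> mval W <= sup E.
    by move=> QW; apply: ub_le_sup; [exact: (proj2 supE)|exists W].
  have : 0 <= sup E by apply: le_trans (supP _ QV0); exact: mval_ge0.
  rewrite le_eqVlt => /predU1P[E0|Epos].
    exists V0 => _; split; [by have [] := QV _ _ fA QV0|by right|].
    move=> W /supP; rewrite -E0 => /le_trans; apply.
    by rewrite mulr_ge0// mval_ge0.
  have [_ [V QAV <-]] := sup_adherent (eps := sup E / 2) ltac:(lra) supE.
  move=> H; exists V => _; split; [by have [] := QV _ _ fA QAV|by right|].
  by move=> W /supP; lra.
have [step stepP] := choice pick.
pose F i := iter i (fun A => A `|` step A) A0.
have fF i : mfin (F i).
  elim: i => [//|i IH]; rewrite /F/= -/(F i); apply: mfinU => //.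
  by have [] := stepP _ IH.
have FS i : F i.+1 = F i `|` step (F i) by [].
have disj i : F i `&` step (F i) = set0.
  have [_ [->|QFi] _] := stepP _ (fF i); first by rewrite setI0.
  by have [] := QV _ _ (fF i) QFi.
have FK i : mval (F i) <= K.
  elim: i => [//|i IH]; rewrite FS.
  have [_ [->|QFi] _] := stepP _ (fF i); first by rewrite setU0.
  by have [] := QV _ _ (fF i) QFi.
have ndF : nondecreasing_seq F.
  by apply/nondecreasing_seqP => i; apply/subsetPset; rewrite FS; exact: subsetUl.
have [fU UK] := mfin_bigcup_bounded fF ndF FK.
exists F, (step \o F); split => //.
  by move=> i; have [] := stepP _ (fF i).
move=> W QW; have [fW _ _] := QV _ _ fU QW.
have QFW i : Q (F i) W by apply: Qanti QW => //; exact: bigcup_sup.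
(* A candidate [W] for the union is a candidate at every stage, so each stage adds at least half its
   measure; a positive [mval W] would exceed the bound [K]. *)
have grow i : i%:R * (mval W / 2) <= mval (F i).
  elim: i => [|i IH]; first by rewrite mul0r mval_ge0.
  have [fV _ /(_ W (QFW i)) HW] := stepP _ (fF i).
  rewrite FS (fin_additiveU mval_sigma)// -natr1 mulrDl mul1r; lra.
apply/eqP; rewrite eq_le mval_ge0 andbT leNgt; apply/negP => W0.
have := archi_boundP (x := K / (mval W / 2)) _.
have K0 : 0 <= K by apply: le_trans A0K; exact: mval_ge0.
move=> /(_ ltac:(apply: divr_ge0 => //; lra)).
rewrite ltr_pdivrMr; last by lra.
by have := grow (Num.Def.archi_bound (K / (mval W / 2))); have := FK (Num.Def.archi_bound (K / (mval W / 2))); lra.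
Qed.

(* A subset of almost minimal positive measure is an atom. *)
Lemma coarse_has_atom Z (r : R) : mfin Z -> 0 < mval Z -> 0 < r ->
  (forall W, measurable W -> W `<=` Z -> mval W = 0 \/ r <= mval W) ->
  exists2 V, matom V & V `<=` Z.
Proof.
move=> fZ Z0 r0 coarse.
pose E : set R := [set mval V | V in [set V | measurable V /\ V `<=` Z /\ 0 < mval V]].
have infE : has_inf E.
  split; first by exists (mval Z); exists Z => //; split; [case: fZ|split].
  by exists 0 => _ [V _ <-]; exact: mval_ge0.
have [_ [V [mV [VZ V0]] <-] VE] := inf_adherent r0 infE.
have fV : mfin V := mfinS fZ mV VZ.
exists V => //; split => // W mW WV.
have := mval_ge0 W; rewrite le_eqVlt => /predU1P[<-|W0]; first by left.
(* As [mval V < inf E + r], this leaves [W] a complement in [V] of measure below [r], hence zero. *)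
right; have WE : inf E <= mval W.
  apply: ge_inf; first exact: (proj2 infE).
  by exists W => //; split => //; split => //; exact: subset_trans VZ.
have := fin_additiveD mval_sigma fV mW WV.
have [||->|] := coarse (V `\` W); [exact: measurableD|by apply: subset_trans VZ|lra|].
by lra.
Qed.

End finite_part.

(** * Linearity for positive measures *)

Lemma setUDid {T : Type} (A B : set T) : A `|` (B `\` A) = A `|` B.
Proof. by rewrite setDE setUIr setUCr setIT. Qed.

Section positive.
Context {d : measure_display} {T : measurableType d} {R : realType}
  (m : {measure set T -> \bar R}) (n : set T -> R).
Local Notation mfin := (mfin m).
Local Notation mval := (mval m).
Local Notation matom := (matom m).
Hypothesis n_sigma : fin_sigma_additive m n.
Hypothesis n_mval : forall A B, mfin A -> mfin B -> mval A = mval B -> n A = n B.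
Let v_sigma := @mval_sigma _ _ _ m.
Let n_set0 := fin_additive0 n_sigma.
Let nD := fin_additiveD n_sigma.
Let vU := fin_additiveU v_sigma.
Let vD := fin_additiveD v_sigma.

Lemma n_null A : mfin A -> mval A = 0 -> n A = 0.
Proof. by move=> fA vA; rewrite -n_set0; apply: n_mval => //; [exact: mfin0|rewrite mval0]. Qed.

(** * Linearity near 0 when small disjoint sets always remain *)

Section splittable.
Variable c : R.
Hypothesis c_gt0 : 0 < c.
Hypothesis split : forall A, mfin A -> mval A < c -> forall r, 0 < r ->
  exists V, [/\ mfin V, A `&` V = set0, 0 < mval V & mval V <= r].

(** Exhaust with disjoint sets while the total stays at most [z]. If the union fell short of [z],
    splitting would give a non-null set that still fits. *)
Lemma splittable_extend A (z : R) : mfin A -> mval A <= z -> z <= c ->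
  exists A', [/\ A `<=` A', mfin A' & mval A' = z].
Proof.
move=> fA Az zc.
pose Q A V := [/\ mfin V, A `&` V = set0 & mval (A `|` V) <= z].
have [||F [V [F0 FS FV [fU Uz] UQ]]] := @exhaustion _ _ _ m Q A z fA Az.
- by move=> B V fB [].
- move=> B B' V fB fB' BB' [fV B'V B'Vz]; split => //.
    by apply/seteqP; split => // x [/BB' B'x Vx]; rewrite -B'V.
  apply: le_trans B'Vz; apply: le_mval; [exact: mfinU|by apply: measurableU; [case: fB|case: fV]|exact: setSU].
exists (\bigcup_i F i); split => //; first by rewrite -F0; exact: bigcup_sup.
apply/eqP; rewrite eq_le Uz/= leNgt; apply/negP => Ultz.
have [|V' [fV' UV' V'0 V'z]] := split fU (lt_le_trans Ultz zc) (r := z - mval (\bigcup_i F i)).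
  by rewrite subr_gt0.
have : Q (\bigcup_i F i) V' by split => //; rewrite vU//; lra.
by move=> /UQ; lra.
Qed.

(** Extend [A] to the measure of [C]: the added part has the measure of [B], so [n] takes the value
    [n B] on it. *)
Lemma splittable_additive A B C : mfin A -> mfin B -> mfin C ->
  mval A + mval B = mval C -> mval C <= c -> n A + n B = n C.
Proof.
move=> fA fB fC ABC Cc; have B0 := mval_ge0 m B.
have [|A' [AA' fA' A'C]] := splittable_extend (z := mval C) fA _ Cc; first by lra.
have mA : measurable A by case: fA.
rewrite -(n_mval fA' fC A'C); have -> : n B = n (A' `\` A).
  apply: n_mval => //; first exact: mfinD.
  by rewrite vD//; lra.
by rewrite nD// addrC subrK.
Qed.

Lemma splittable_sets (z : R) : 0 <= z -> z <= c -> exists A, mfin A /\ mval A = z.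
Proof.
move=> z0 zc.
have [|A [_ fA Az]] := splittable_extend (z := z) (mfin0 m) _ zc; first by rewrite mval0.
by exists A.
Qed.

(** By additivity [n] is [j] times its value on a set of measure [c / N%:R]; the case [j = N]
    determines that value from [n C]. *)
Lemma splittable_rational C A (N j : nat) : mfin C -> mval C = c -> mfin A ->
  (0 < N)%N -> (j <= N)%N -> mval A = j%:R * (c / N%:R) -> n A = j%:R * (n C / N%:R).
Proof.
move=> fC Cc fA N0 jN Aj.
have N0' : 0 < N%:R :> R by rewrite ltr0n.
have c0 : 0 <= c / N%:R by apply: divr_ge0 => //; exact: ltW.
have jc k : (k <= N)%N -> k%:R * (c / N%:R) <= c.
  move=> kN; rewrite mulrA ler_pdivrMr// mulrC.
  by apply: ler_wpM2l; [exact: ltW|rewrite ler_nat].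
have [||B [fB Bc]] := splittable_sets (z := c / N%:R) => //.
  by have := jc 1%N N0; rewrite mul1r.
have mul k X : mfin X -> (k <= N)%N -> mval X = k%:R * (c / N%:R) -> n X = k%:R * n B.
  elim: k X => [|k IH] X fX kN Xk.
    by rewrite mul0r; apply: n_null => //; rewrite Xk mul0r.
  have [||Y [fY Yk]] := splittable_sets (z := k%:R * (c / N%:R)).
  - by apply: mulr_ge0.
  - by apply: jc; exact: ltnW.
  rewrite -natr1 mulrDl mul1r -(IH Y fY (ltnW kN) Yk); apply/esym.
  apply: splittable_additive => //; last by rewrite Xk; exact: jc.
  by rewrite Yk Bc Xk -natr1 mulrDl mul1r.
rewrite (mul j)// (mul N C)//; last by rewrite Cc mulrC divfK// gt_eqF.
by rewrite [N%:R * _]mulrC mulfK// gt_eqF.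
Qed.

(** Dyadic multiples of [c] increasing to [mval A] are realized by an increasing chain of sets; [n]
    is known on the chain and passes to its union, which has the measure of [A]. *)
Lemma splittable_linear : exists alpha, forall A, mfin A -> mval A <= c ->
  n A = alpha * mval A.
Proof.
have [||C [fC Cc]] := splittable_sets (z := c) => //; first exact: ltW.
exists (n C / c) => A fA Ac; set x := mval A.
have x0 : 0 <= x by exact: mval_ge0.
(* [s i] is [x] rounded down to a multiple of [c / (2 ^ i)%:R]. *)
pose k i := Num.truncn (x / (c / (2 ^ i)%:R)).
pose s i : R := (k i)%:R * (c / (2 ^ i)%:R).
have p0 i : 0 < (2 ^ i)%:R :> R by rewrite ltr0n expn_gt0.
have cp0 i : 0 < c / (2 ^ i)%:R by apply: divr_gt0.
have kP i : s i <= x < s i + c / (2 ^ i)%:R.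
  have := @truncn_itv R (x / (c / (2 ^ i)%:R)) ltac:(apply: divr_ge0 => //; exact: ltW).
  by rewrite ler_pdivlMr// ltr_pdivrMr// -/(k i) -natr1 mulrDl mul1r.
have kN i : (k i <= 2 ^ i)%N.
  rewrite -(ler_nat R) -(ler_pM2r (cp0 i)) -/(s i).
  have -> : (2 ^ i)%:R * (c / (2 ^ i)%:R) = c by rewrite mulrC divfK// gt_eqF.
  by have /andP[+ _] := kP i; move=> /le_trans; apply.
have sE i : s i = (2 * k i)%:R * (c / (2 ^ i.+1)%:R).
  by rewrite /s expnS !natrM; field; exact/lt0r_neq0/p0.
have s_nd i : s i <= s i.+1.
  rewrite sE /s ler_pM2r// ler_nat /k truncn_ge_nat; last first.
    by apply: divr_ge0 => //; exact: ltW.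
  by rewrite ler_pdivlMr// -/(k i) -sE; case/andP: (kP i).
have ext A0 z : exists A', mfin A0 -> mval A0 <= z -> z <= c ->
    [/\ A0 `<=` A', mfin A' & mval A' = z].
  have [[fA0 [A0z zc]]|nP] := pselect (mfin A0 /\ mval A0 <= z /\ z <= c).
    by have [B HB] := splittable_extend fA0 A0z zc; exists B.
  by exists set0 => f1 f2 f3; exfalso; apply: nP.
pose E A0 z := projT1 (cid (ext A0 z)).
have EP A0 z := projT2 (cid (ext A0 z)) : mfin A0 -> mval A0 <= z -> z <= c ->
  [/\ A0 `<=` E A0 z, mfin (E A0 z) & mval (E A0 z) = z].
pose B i := iteri i (fun j X => E X (s j.+1)) (E set0 (s 0%N)).
have sc i : s i <= c by have /andP[+ _] := kP i; move=> /le_trans; apply.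
have s0 i : 0 <= s i by apply: mulr_ge0 => //; exact: ltW.
have BP i : mfin (B i) /\ mval (B i) = s i.
  elim: i => [|i [fBi Bis]].
    by have [|_ ? ?] := EP set0 (s 0%N) (mfin0 m) _ (sc 0%N); first by rewrite mval0.
  by have [|_ ? ?] := EP (B i) (s i.+1) fBi _ (sc i.+1); first by rewrite Bis.
have ndB : nondecreasing_seq B.
  apply/nondecreasing_seqP => i; apply/subsetPset.
  have [fBi Bis] := BP i.
  by have [|? _ _] := EP (B i) (s i.+1) fBi _ (sc i.+1); first by rewrite Bis.
have fB i : mfin (B i) by case: (BP i).
have mB i : measurable (B i) by case: (fB i).
have Bx i : mval (B i) <= x by rewrite (proj2 (BP i)); case/andP: (kP i).
have [fU Ux] := mfin_bigcup_bounded fB ndB Bx.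
have scvg : s @ \oo --> x.
  have gcvg : (fun i => x - c / (2 ^ i)%:R) @ \oo --> x.
    rewrite -[X in _ --> X](subr0 x); apply: cvgB; first exact: cvg_cst.
    have := @cvg_geometric R c (2^-1) ltac:(rewrite ger0_norm; lra).
    apply: cvg_trans; apply: near_eq_cvg; apply: nearW => i.
    by rewrite /geometric/= natrX exprVn.
  apply: (squeeze_cvgr _ gcvg); last exact: cvg_cst.
  by apply: nearW => i; have /andP[-> ?] := kP i; rewrite andbT; lra.
have vcvg := fin_cvg_nondecreasing v_sigma mB ndB (proj2 fU).
have ncvg := fin_cvg_nondecreasing n_sigma mB ndB (proj2 fU).
have Uxe : mval (\bigcup_i B i) = x.
  apply: (cvg_unique (@Rhausdorff R) vcvg).
  by apply: cvg_trans scvg; apply: near_eq_cvg; apply: nearW => i; case: (BP i).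
rewrite -(n_mval fU fA Uxe).
apply: (cvg_unique (@Rhausdorff R) ncvg).
have H := cvgM (@cvg_cst _ (n C / c) _ \oo _) scvg.
rewrite (_ : (fun i => n (B i)) = cst (n C / c) * s); first exact: H.
apply/funext => i; rewrite !fctE.
have [fBi Bis] := BP i.
rewrite (splittable_rational fC Cc fBi _ (kN i) Bis) ?expn_gt0//.
by rewrite /s; field; rewrite !gt_eqF.
Qed.

End splittable.

Hypothesis range_mval : forall A (z : R), mfin A -> 0 <= z -> z <= mval A ->
  exists C, mfin C /\ mval C = z.

(** * Linearity near 0 in the atomic case *)

Section atomic.
Hypothesis nsplit : forall c : R, 0 < c -> exists A r, [/\ mfin A, mval A < c, 0 < r &
  forall V, mfin V -> A `&` V = set0 -> mval V = 0 \/ r < mval V].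

(** Remove from [Z] a set of smaller measure that has no small non-null sets disjoint from it; what
    remains is non-null and coarse. *)
Lemma atomic_has_atom Z : mfin Z -> 0 < mval Z -> exists2 V, matom V & V `<=` Z.
Proof.
move=> fZ Z0; have [A [r [fA AZ r0 coarse]]] := nsplit Z0.
have mA : measurable A by case: fA.
have ZA0 : 0 < mval (Z `\` A).
  have := fin_additiveID v_sigma fZ mA.
  have : mval (Z `&` A) <= mval A by apply: le_mval => //; case: (mfinI fZ mA).
  by lra.
have [|V aV VZ] := coarse_has_atom (mfinD fZ mA) ZA0 r0.
  move=> W mW WZ; have fW : mfin W by apply: mfinS fZ mW _; apply: subset_trans WZ _.
  have [||->|/ltW] := coarse W => //; [|by left|by right].
  by apply/seteqP; split => // x [Ax /WZ[]].
by exists V => //; apply: subset_trans VZ _.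
Qed.

Lemma atomic_linear X (eps M : R) : mfin X -> 0 < mval X -> 0 < eps ->
  (forall A, matom A -> mval A < eps -> `|n A| <= M * mval A) ->
  exists c alpha, 0 < c /\ forall A, mfin A -> mval A <= c -> n A = alpha * mval A.
Proof.
move=> fX X0 eps0 atomM; have [E [r [fE _ r0 coarse]]] := nsplit ltr01.
have mE : measurable E by case: fE.
(* The bound [r] places sets of measure below [rho] inside [E] up to null sets, [eps] makes the
   ratio bound available, and [mval X] ensures that all values below [rho] are attained. *)
pose rho := Num.min r (Num.min eps (mval X)).
have rho0 : 0 < rho by rewrite !lt_min r0 eps0.
have /and3P[rhor rhoe rhoX] : [&& rho <= r, rho <= eps & rho <= mval X].
  by rewrite /rho !ge_min !lexx !orbT.
pose Q A V := [/\ A `<=` E, V `<=` E, A `&` V = set0, matom V & mval V < rho].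
have E0 : mval set0 <= mval E by rewrite mval0 mval_ge0.
have [||F [e [F0 FS FP [fU _] UQ]]] := @exhaustion _ _ _ m Q set0 (mval E) (mfin0 m) E0.
- move=> A V fA [AE VE AV [fV _ _] _]; split => //.
  by apply: le_mval => //; [apply: measurableU; [case: fA|case: fV]|rewrite subUset].
- move=> A A' V fA fA' AA' [AE VE AV aV Vr]; split => //; first exact: subset_trans AE.
  by apply/seteqP; split => // x [/AA' A'x Vx]; rewrite -AV.
have fe i : mfin (e i) by case: (FP i) => _ [].
have me i : measurable (e i) by case: (fe i).
have eP i : e i = set0 \/ [/\ e i `<=` E, matom (e i) & mval (e i) < rho].
  by case: (FP i) => _ [_ [_ [|[_ ? _ ? ?]]]]; [left|right].
have eE i : e i `<=` E by case: (eP i) => [->|[]].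
have ndF : nondecreasing_seq F.
  by apply/nondecreasing_seqP => i; apply/subsetPset; rewrite FS; exact: subsetUl.
have te : trivIset setT e.
  have lt i j : (i < j)%N -> e i `&` e j = set0.
    move=> ij; case: (FP j) => _ [_ [Fj _]]; apply/seteqP; split => // x [eix ejx].
    rewrite -Fj; split => //; have /subsetPset := ndF _ _ ij; apply.
    by rewrite FS; right.
  apply/trivIsetP => i j _ _; rewrite neq_lt => /orP[|] ij; first exact: lt.
  by rewrite setIC; exact: lt.
have Ue : \bigcup_i F i = \bigcup_i e i.
  apply/seteqP; split => x [i _].
    elim: i => [|i IH]; first by rewrite F0.
    by rewrite FS => -[/IH//|eix]; exists i.
  by move=> eix; exists i.+1 => //; rewrite FS; right.
have mUe : measurable (\bigcup_i e i) by exact: bigcup_measurable.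
have UeE : \bigcup_i e i `<=` E by move=> x [i _ /eE].
pose a i := mval (e i); pose b i := n (e i).
have a0 i : 0 <= a i by exact: mval_ge0.
have arho i : a i < rho.
  by rewrite /a; case: (eP i) => [->|[]//]; rewrite mval0.
have bM i : `|b i| <= M * a i.
  rewrite /a /b; case: (eP i) => [->|[_ ? ?]]; first by rewrite n_set0 mval0 mulr0 normr0.
  by apply: atomM => //; exact: lt_le_trans rhoe.
have wsumU q S : fin_sigma_additive m q ->
    q (\bigcup_i (if S i then e i else set0)) = wsum (fun i => q (e i)) S.
  move=> sq.
  have := @sq (fun i => if S i then e i else set0).
  have sub : \bigcup_i (if S i then e i else set0) `<=` \bigcup_i e i.
    by apply: subset_bigcup => i _; case: (S i).
  have mS i : measurable (if S i then e i else set0) by case: (S i).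
  have tS : trivIset setT (fun i => if S i then e i else set0).
    apply/trivIsetP => i j _ _ ij; case: (S i); case: (S j); rewrite ?set0I ?setI0//.
    by move/trivIsetP : te; exact.
  have fS : mfin (\bigcup_i (if S i then e i else set0)).
    by apply: mfinS fE _ _; [exact: bigcup_measurable|exact: subset_trans UeE].
  move=> /(_ mS tS (proj2 fS)) H; apply/esym/cvg_lim => //.
  apply: cvg_trans H; apply: near_eq_cvg; apply: nearW => k.
  apply: eq_bigr => i _; case: (S i); rewrite /= ?mulr1n//.
  by rewrite (fin_additive0 sq).
have fUS (S : nat -> bool) : mfin (\bigcup_i (if S i then e i else set0)).
  apply: mfinS fE _ _; first by apply: bigcup_measurable => i _; case: (S i).
  by apply: subset_trans UeE; apply: subset_bigcup => i _; case: (S i).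
have rep B : mfin B -> mval B < rho -> exists S : nat -> bool,
    mval B = wsum a S /\ n B = wsum b S.
  move=> fB Br; have mB : measurable B by case: fB.
  pose B0 := B `&` \bigcup_i e i.
  have mB0 : measurable B0 by exact: measurableI.
  have fB0 : mfin B0 by exact: mfinI.
  have out0 : mval (B `\` E) = 0.
    have [|//|] := coarse (B `\` E) (mfinD fB mE).
      by rewrite setDE setICA setICr setI0.
    have : mval (B `\` E) <= mval B by apply: le_mval => //; exact: measurableD.
    by lra.
  have mBE : measurable (B `&` E) by exact: measurableI.
  have fBE : mfin (B `&` E) by exact: mfinI.
  (* A non-null rest would contain an atom of measure below [rho] disjoint from all [e i], against
     the exhaustion. *)
  have rest0 : mval ((B `&` E) `\` \bigcup_i e i) = 0.
    apply/eqP; rewrite eq_le mval_ge0 andbT leNgt; apply/negP => Z0.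
    have [V aV VZ] := atomic_has_atom (mfinD fBE mUe) Z0.
    have [fV V0 _] := aV.
    have : mval V <= mval B.
      by apply: le_mval => //; [case: fV|move=> x /VZ[[]]].
    move=> VB; suff /UQ : Q (\bigcup_i F i) V by lra.
    rewrite Ue; split => //; [by move=> x /VZ[[]]| |by lra].
    by apply/seteqP; split => // x [? /VZ[]].
  have BB0 : mval B = mval B0.
    rewrite (fin_additiveID v_sigma fB mE) out0 addr0.
    rewrite (fin_additiveID v_sigma fBE mUe) rest0 addr0; congr mval.
    by rewrite /B0 -setIA (setIidr UeE).
  (* An atom meets [B] either in a null set or in its full measure, so [B] is up to null sets the
     union of the atoms it charges. *)
  pose S i := 0 < mval (B `&` e i).
  exists S.
  have repq q : fin_sigma_additive m q ->
      (forall A C, mfin A -> mfin C -> mval A = mval C -> q A = q C) ->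
      q B = wsum (fun i => q (e i)) S.
    move=> sq vq; rewrite (vq B B0 fB fB0 BB0).
    have := @sq (fun i => B `&` e i); rewrite -setI_bigcupr => /(_ _ _ (proj2 fB0)) H.
    have {}H : series (fun i => q (B `&` e i)) @ \oo --> q B0.
      by apply: H => [i|]; [exact: measurableI|exact: trivIset_setIl].
    apply/esym/cvg_lim => //; apply: cvg_trans H; apply: near_eq_cvg; apply: nearW => k.
    apply: eq_bigr => i _.
    have fBe : mfin (B `&` e i) by exact: mfinI.
    have : 0 <= mval (B `&` e i) by exact: mval_ge0.
    rewrite /S le_eqVlt => /predU1P[Be0|Be0].
      rewrite -Be0 ltxx mulr0n -(fin_additive0 sq).
      by apply: vq => //; [exact: mfin0|rewrite mval0].
    rewrite Be0 mulr1n; apply: vq => //.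
    have [ei0|[_ [_ _ aei] _]] := eP i.
      by move: Be0; rewrite ei0 setI0 mval0 ltxx.
    have [||eq0|//] := aei (B `&` e i); [by case: fBe|exact: subIsetr|].
    by rewrite eq0 ltxx in Be0.
  by split; apply: repq.
have ca : cvgn (series a).
  exact: cvgP (v_sigma me te (proj2 (mfinS fE mUe UeE))).
have [||alpha lin] := @subsum_linear R a rho a0 ca _ b M rho0 arho bM.
- move=> x /andP[x0 xr].
  have [|C [fC Cx]] := range_mval (z := x) fX x0; first by lra.
  have [|S [HS _]] := rep C fC; first by rewrite Cx.
  by exists S; rewrite -HS.
- move=> S S' SS'; rewrite -!wsumU//; apply: n_mval => //.
  by rewrite !wsumU.
exists (rho / 2), alpha; split; first by rewrite divr_gt0.
move=> A fA Ar; have [|S [SA nA]] := rep A fA; first by lra.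
by rewrite nA SA lin// -SA.
Qed.

End atomic.

(* From sets of small measure to all sets: [w] is the infimum of the measures of
   the sets on which [k = n - alpha m] does not vanish; sets of measure below
   [w] fill the gaps between the bad atoms of measure close to [w]. *)
Section extension.
Context (c alpha : R).
Hypothesis c_gt0 : 0 < c.
Hypothesis linear_small : forall A, mfin A -> mval A <= c -> n A = alpha * mval A.

Let k A := n A - alpha * mval A.

Lemma defect_sigma : fin_sigma_additive m k.
Proof.
move=> F mF tF fF.
have H := cvgB (n_sigma mF tF fF) (cvgM (@cvg_cst _ alpha _ \oo _) (v_sigma mF tF fF)).
rewrite (_ : series _ = series (fun i => n (F i)) - cst alpha * series (fun i => mval (F i))); first exact: H.
by apply/funext => i; rewrite !fctE /series/= /k sumrB -mulr_sumr.
Qed.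

Let kU := fin_additiveU defect_sigma.
Let kD := fin_additiveD defect_sigma.

Lemma defect_mval A B : mfin A -> mfin B -> mval A = mval B -> k A = k B.
Proof. by move=> fA fB AB; rewrite /k AB (n_mval fA fB AB). Qed.

Lemma defect_null A : mfin A -> mval A = 0 -> k A = 0.
Proof. by move=> fA A0; rewrite /k A0 mulr0 subr0 n_null. Qed.

(** A set of smaller measure cannot carry the measure of an atom, so it meets the atom in a null set
    and the two add as if disjoint. *)
Lemma atom_setU V Y : matom V -> mfin Y -> mval Y < mval V ->
  [/\ mfin (V `|` Y), mval (V `|` Y) = mval V + mval Y & k (V `|` Y) = k V + k Y].
Proof.
move=> [fV V0 aV] fY YV; have [mV _] := fV; have [mY _] := fY.
have mYV : measurable (Y `&` V) by exact: measurableI.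
have YV0 : mval (Y `&` V) = 0.
  have [||//|YVV] := aV (Y `&` V) => //.
  by have : mval (Y `&` V) <= mval Y by [exact: le_mval]; lra.
have YD : mval (Y `\` V) = mval Y.
  by have := fin_additiveID v_sigma fY mV; rewrite YV0 add0r.
have fYD : mfin (Y `\` V) by exact: mfinD.
have VD0 : V `&` (Y `\` V) = set0 by rewrite setDE setICA setICr setI0.
rewrite -setUDid.
split; [exact: mfinU|by rewrite vU// YD|].
by rewrite kU// (defect_mval fYD fY YD).
Qed.

Lemma defect_eq0 A : mfin A -> k A = 0.
Proof.
move=> fA0; apply: contrapT => kA0.
pose D : set R := [set mval U | U in [set U | mfin U /\ k U <> 0]].
have infD : has_inf D.
  split; first by exists (mval A); exists A.
  by exists 0 => _ [U _ <-]; exact: mval_ge0.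
pose w := inf D.
have le_w U : mfin U -> k U <> 0 -> w <= mval U.
  by move=> fU kU0; apply: ge_inf; [exact: (proj2 infD)|exists U].
have small U : mfin U -> mval U < w -> k U = 0.
  by move=> fU Uw; apply: contrapT => /(le_w _ fU); lra.
have w0 : 0 < w.
  apply: lt_le_trans c_gt0 _; apply: lb_le_inf; first by case: infD.
  move=> _ [U [fU kU0] <-]; rewrite leNgt; apply/negP => /ltW Uc.
  by apply: kU0; rewrite /k linear_small// subrr.
have wA : w <= mval A by exact: le_w.
have sets z : 0 <= z -> z < w -> exists Y, [/\ mfin Y, mval Y = z & k Y = 0].
  move=> z0 zw; have [|Y [fY Yz]] := range_mval (z := z) fA0 z0; first by lra.
  by exists Y; split => //; apply: small => //; rewrite Yz.
have bad_atom U : mfin U -> k U <> 0 -> exists2 V, matom V /\ k V <> 0 & mval V <= mval U.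
  move=> fU kU0; have [mU _] := fU.
  (* Exhaust [U] by sets on all of whose subsets [k] vanishes. In the rest, any set of measure below
     [w] is of this kind, hence null, so the rest is coarse; an atom of it with [k = 0] would be of
     this kind too. *)
  pose Q B V := [/\ mfin V, B `&` V = set0, B `<=` U, V `<=` U &
    forall W, measurable W -> W `<=` V -> k W = 0].
  have U0 : mval set0 <= mval U by rewrite mval0 mval_ge0.
  have [||F [V [F0 FS FP [fG _] GQ]]] := @exhaustion _ _ _ m Q set0 (mval U) (mfin0 m) U0.
  - move=> B V fB [fV BV BU VU _]; split => //.
    by apply: le_mval => //; [apply: measurableU; [case: fB|case: fV]|rewrite subUset].
  - move=> B B' V fB fB' BB' [fV B'V B'U VU gV]; split => //; last exact: subset_trans B'U.
    by apply/seteqP; split => // x [/BB' B'x Vx]; rewrite -B'V.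
  have FU i : F i `<=` U.
    elim: i => [|i IH]; first by rewrite F0.
    rewrite FS subUset; split => //.
    by case: (FP i) => _ [_ [_ [->|[]]]].
  have GU : \bigcup_i F i `<=` U by move=> x [i _ /FU].
  have kF i : k (F i) = 0.
    elim: i => [|i IH]; first by rewrite F0 (fin_additive0 defect_sigma).
    have [fFi [fVi [FVi gVi]]] := FP i; rewrite FS kU// IH add0r.
    case: gVi => [->|[_ _ _ _ gV]]; first exact: (fin_additive0 defect_sigma).
    by apply: gV => //; case: fVi.
  have kG : k (\bigcup_i F i) = 0.
    have ndF : nondecreasing_seq F.
      by apply/nondecreasing_seqP => i; apply/subsetPset; rewrite FS; exact: subsetUl.
    have mF i : measurable (F i) by case: (FP i) => -[].
    have := fin_cvg_nondecreasing defect_sigma mF ndF (proj2 fG).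
    move/(cvg_unique (@Rhausdorff R)); apply; apply: cvg_near_cst.
    by apply: nearW => i; exact: kF.
  have [mG _] := fG.
  pose Z := U `\` \bigcup_i F i.
  have fZ : mfin Z by exact: mfinD.
  have kZ : k Z = k U by rewrite kD// kG subr0.
  have Z0 : 0 < mval Z.
    rewrite lt_neqAle mval_ge0 andbT eq_sym; apply/eqP => /(defect_null fZ).
    by rewrite kZ.
  have QZ W : measurable W -> W `<=` Z -> (forall W', measurable W' -> W' `<=` W -> k W' = 0) ->
      mval W = 0.
    move=> mW WZ gW; apply: GQ; split => //.
    - exact: mfinS fZ mW WZ.
    - by apply/seteqP; split => // x [? /WZ[]].
    - by move=> x /WZ[].
  have [|V' aV' V'Z] := coarse_has_atom fZ Z0 w0.
    move=> W mW WZ; have [wW|Ww] := leP w (mval W); [by right|left].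
    apply: QZ => // W' mW' W'W; have fW : mfin W by exact: mfinS fZ mW WZ.
    apply: small; first exact: mfinS fW mW' W'W.
    by apply: le_lt_trans Ww; exact: le_mval.
  have [fV' V'0 aV] := aV'; have [mV' _] := fV'.
  exists V'; last by apply: le_mval => // x /V'Z[].
  split => // kV'; have : mval V' = 0; last by lra.
  apply: QZ => // W mW WV'; have fW := mfinS fV' mW WV'.
  have [W0|WV] := aV _ mW WV'; first exact: defect_null.
  by rewrite (defect_mval fW fV' WV).
have near_w eta : 0 < eta -> exists V, [/\ matom V, k V <> 0, w <= mval V & mval V < w + eta].
  move=> /inf_adherent => /(_ _ infD)[_ [U [fU kU0] <-]] Uw.
  have [V [aV kV] VU] := bad_atom U fU kU0.
  by exists V; split => //; [apply: le_w => //; case: aV|exact: le_lt_trans Uw].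
have [[V [aV kV Vw]]|nattained] := pselect (exists V, [/\ matom V, k V <> 0 & mval V = w]).
  (* Otherwise sets with [k = 0] and measure below [2 * w] have measure below [w]. Successive unions
     of such sets of measure [i%:R / i.+1%:R * w] never cross this gap, yet their total union has
     measure at least [w]. *)
  have [X [fX kX wX Xw]] : exists X, [/\ mfin X, k X = 0, w <= mval X & mval X < 2 * w].
    apply: contrapT => /forallNP nX.
    have lt_w X : mfin X -> k X = 0 -> mval X < 2 * w -> mval X < w.
      by move=> fX kX X2; rewrite ltNge; apply/negP => wX; apply: (nX X).
    have ltz i : i%:R / i.+1%:R * w < w.
      rewrite -ltr_pdivlMr// divff ?gt_eqF// ltr_pdivrMr ?mul1r ?ltr_nat// ltr0n//.
    have Yex i : exists Y, [/\ mfin Y, mval Y = i%:R / i.+1%:R * w & k Y = 0].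
      by apply: sets => //; rewrite mulr_ge0 ?divr_ge0// ltW.
    have [Y YP] := choice Yex.
    pose B i := iteri i (fun j X => X `|` Y j) set0.
    have BS i : B i.+1 = B i `|` Y i by [].
    have BP i : [/\ mfin (B i), k (B i) = 0 & mval (B i) < w].
      elim: i => [|i [fB kB Bw]].
        by split; [exact: mfin0|exact: (fin_additive0 defect_sigma)|rewrite mval0].
      have [fY Yi kY] := YP i; have Yw := ltz i; rewrite -Yi in Yw.
      have [mB _] := fB.
      have fD : mfin (Y i `\` B i) by exact: mfinD.
      have Dw : mval (Y i `\` B i) < w.
        by apply: le_lt_trans Yw; apply: le_mval => //; case: fD.
      have BSE : B i.+1 = B i `|` (Y i `\` B i).
        by rewrite BS setUDid.
      have BD0 : B i `&` (Y i `\` B i) = set0 by rewrite setDE setICA setICr setI0.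
      have fBS : mfin (B i.+1) by rewrite BSE; exact: mfinU.
      have kBS : k (B i.+1) = 0 by rewrite BSE kU// kB (small _ fD Dw) addr0.
      split => //; apply: lt_w => //; rewrite BSE vU//; lra.
    have fB i : mfin (B i) by case: (BP i).
    have ndB : nondecreasing_seq B.
      by apply/nondecreasing_seqP => i; apply/subsetPset; rewrite BS; exact: subsetUl.
    have Bw i : mval (B i) <= w by case: (BP i) => _ _ /ltW.
    have [fU Uw] := mfin_bigcup_bounded fB ndB Bw.
    have mB i : measurable (B i) by case: (fB i).
    have kU0 : k (\bigcup_i B i) = 0.
      have := fin_cvg_nondecreasing defect_sigma mB ndB (proj2 fU).
      move/(cvg_unique (@Rhausdorff R)); apply; apply: cvg_near_cst.
      by apply: nearW => i; case: (BP i).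
    have Ult : mval (\bigcup_i B i) < w by apply: lt_w => //; lra.
    have UY i : w - w / i.+1%:R <= mval (\bigcup_i B i).
      have [[mY _] Yi _] := YP i.
      have -> : w - w / i.+1%:R = mval (Y i).
        rewrite Yi -(natr1 i); field.
        by rewrite natr1 pnatr_eq0.
      by apply: le_mval => // x Yx; exists i.+1 => //; rewrite BS; right.
    set u := mval _ in Ult UY.
    have := archi_boundP (x := w / (w - u)) ltac:(apply: divr_ge0; lra).
    set i := Num.Def.archi_bound _; rewrite ltr_pdivrMr; last by lra.
    move=> Hi; have := UY i; rewrite lerBlDr -lerBlDl ler_pdivlMr ?ltr0n// -natr1.
    by rewrite mulrDr mulr1 mulrC; lra.
  (* Adding [Y] to [V] reaches the measure of [X], although [k] is [k V] there and 0 on [X]. *)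
  have [||Y [fY Yx kY]] := sets (mval X - w); [lra..|].
  have [|fVY VYx kVY] := atom_setU aV fY; first by lra.
  have : k X = k (V `|` Y) by apply: defect_mval => //; lra.
  by rewrite kVY kX kY addr0 => /esym.
have gt_w V : matom V -> k V <> 0 -> w < mval V.
  move=> aV kV; rewrite lt_neqAle le_w ?andbT//; last by case: aV.
  by apply/eqP => Vw; apply: nattained; exists V.
(* The larger atom has the measure of the smaller one enlarged by a set of measure below [w], where
   [k] vanishes. *)
have same V V' : matom V -> matom V' -> k V <> 0 -> k V' <> 0 ->
    mval V' < mval V -> mval V < 2 * w -> k V = k V'.
  move=> aV aV' kV kV' V'V V2; have := gt_w _ aV' kV' => wV'.
  have [||Y [fY Yv kY]] := sets (mval V - mval V'); [lra..|].
  have [|fVY VYx kVY] := atom_setU aV' fY; first by lra.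
  rewrite -[k V']addr0 -kY -kVY; apply: defect_mval => //; first by case: aV.
  by lra.
(* The tolerances make the three measures decreasing, between [w] and [2 * w], with
   [mval V2 + mval V3 - mval V1 < w]. *)
have [V1 [a1 k1 _ v1]] := near_w w w0; have w1 := gt_w _ a1 k1.
have [|V2 [a2 k2 _ v2]] := near_w ((mval V1 - w) / 2); first by lra.
have w2 := gt_w _ a2 k2.
have [|V3 [a3 k3 _ v3]] := near_w (mval V2 - w); first by lra.
have w3 := gt_w _ a3 k3.
have [f1 _ _] := a1; have [f3 _ _] := a3.
have k12 : k V1 = k V2 by apply: same => //; lra.
have k13 : k V1 = k V3 by apply: same => //; lra.
have [|f23 v23 k23] := atom_setU a2 f3; first by lra.
(* This completes [V1] to the measure of the union of [V2] and [V3]; [k] equals [k V1] on the one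
   and twice [k V1] on the other. *)
have [||Y [fY Yv kY]] := sets (mval V2 + mval V3 - mval V1); [lra..|].
have [|f1Y v1Y k1Y] := atom_setU a1 fY; first by lra.
have : k (V1 `|` Y) = k (V2 `|` V3) by apply: defect_mval => //; lra.
by rewrite k1Y k23 kY; lra.
Qed.

End extension.

Theorem positive_linear : (exists eps M : R, 0 < eps /\
    forall A, matom A -> mval A < eps -> `|n A| <= M * mval A) ->
  exists alpha, forall A, mfin A -> n A = alpha * mval A.
Proof.
move=> [eps [M [eps0 atomM]]].
have [[X [fX X0]]|nX] := pselect (exists X, mfin X /\ 0 < mval X); last first.
  exists 0 => A fA; rewrite mul0r n_null//.
  apply/eqP; rewrite eq_le mval_ge0 andbT leNgt; apply/negP => A0.
  by apply: nX; exists A.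
suff [c [alpha [c0 lin]]] : exists c alpha, 0 < c /\
    forall A, mfin A -> mval A <= c -> n A = alpha * mval A.
  exists alpha => A fA; apply/eqP; rewrite -subr_eq0; apply/eqP.
  exact: (defect_eq0 c0 lin).
have [[c [c0 csplit]]|nsplit] := pselect (exists c : R, 0 < c /\
    forall A, mfin A -> mval A < c -> forall r, 0 < r ->
      exists V, [/\ mfin V, A `&` V = set0, 0 < mval V & mval V <= r]).
  by have [alpha lin] := splittable_linear c0 csplit; exists c, alpha.
apply: (atomic_linear _ fX X0 eps0 atomM) => c c0.
apply: contrapT => nA; apply: nsplit; exists c; split => // A fA Ac r r0.
apply: contrapT => nV; apply: nA; exists A, r; split => // V fV AV.
have [rV|Vr] := ltP r (mval V); [by right|left].
apply/eqP; rewrite eq_le mval_ge0 andbT leNgt; apply/negP => V0.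
by apply: nV; exists V.
Qed.

End positive.

(** * Reduction of signed measures to positive measures *)

Section signed_measure.
Context {d : measure_display} {T : measurableType d} {R : realType}.
Variable mu : set T -> \bar R.
Hypothesis smu : is_signed_measure mu.
Local Open Scope ereal_scope.

Lemma signed0 : mu set0 = 0. Proof. by case: smu. Qed.

Lemma signed_sigma F : (forall i, measurable (F i)) -> trivIset setT F ->
  (fun k => \sum_(0 <= i < k) mu (F i)) @ \oo --> mu (\bigcup_i F i).
Proof. by move=> mF tF; case: smu => _ [_]; exact. Qed.

Lemma signedU A B : measurable A -> measurable B -> A `&` B = set0 ->
  mu (A `|` B) = mu A + mu B.
Proof.
move=> mA mB AB0.
have H : (fun k => \sum_(0 <= i < k) mu (bigcup2 A B i)) @ \oo --> mu (A `|` B).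
  rewrite -bigcup2E; apply: signed_sigma; last by rewrite -trivIset_bigcup2.
  by move=> [|[|i]]; rewrite /bigcup2/=; [exact: mA|exact: mB|exact: measurable0].
apply: (cvg_unique (@ereal_hausdorff R) H); apply: cvg_near_cst.
exists 2%N => // -[|[|k]]// _; rewrite !big_nat_recl//= big1 ?adde0// => i _.
exact: signed0.
Qed.

Lemma signedID A B : measurable A -> measurable B ->
  mu A = mu (A `&` B) + mu (A `\` B).
Proof.
move=> mA mB; rewrite -signedU ?setUIDK//; [exact: measurableI|exact: measurableD|].
by rewrite setDE setIACA setICr setI0.
Qed.

Lemma signed_fin_sub A B : measurable A -> measurable B -> A `<=` B ->
  mu B \is a fin_num -> mu A \is a fin_num.
Proof.
by move=> mA mB AB; rewrite (signedID mB mA) (setIidr AB) fin_numD => /andP[].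
Qed.

Lemma signed_adde_def A B : measurable A -> measurable B -> mu A +? mu B.
Proof.
move=> mA mB; case: smu => _ [nmu _]; rewrite /adde_def.
apply/andP; split; apply/negP => /andP[/eqP A1 /eqP B1]; apply: nmu.
  by split; [exists A|exists B].
by split; [exists B|exists A].
Qed.

Lemma signed_fine_sigma F : (forall i, measurable (F i)) -> trivIset setT F ->
  mu (\bigcup_i F i) \is a fin_num ->
  series (fun i => fine (mu (F i))) @ \oo --> fine (mu (\bigcup_i F i)).
Proof.
move=> mF tF fF.
have fFi i : mu (F i) \is a fin_num.
  by apply: signed_fin_sub fF => //; [exact: bigcup_measurable|exact: bigcup_sup].
have := signed_sigma mF tF; rewrite -(fineK fF) => /fine_cvg.
apply: cvg_trans; apply: near_eq_cvg; apply: nearW => k /=.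
rewrite /series/= (eq_bigr (fun i => (fine (mu (F i)))%:E)) ?sumEFin// => i _.
by rewrite fineK.
Qed.

End signed_measure.

(** * Invariance of the hypotheses under change of sign *)

Section negation.
Context {d : measure_display} {T : measurableType d} {R : realType}.
Variable mu : set T -> \bar R.
Local Open Scope ereal_scope.

Lemma signed_measureN : is_signed_measure mu -> is_signed_measure (fun A => - mu A).
Proof.
move=> smu; split; first by rewrite (signed0 smu) oppe0.
split.
  move=> [[A [mA A1]] [B [mB B1]]]; case: (smu) => _ [nmu _]; apply: nmu.
  by split; [exists B|exists A]; split => //; rewrite -[LHS]oppeK ?A1 ?B1.
move=> F mF tF; have H := cvgeN (signed_sigma smu mF tF).
rewrite (_ : (fun k => _) = fun k => - \sum_(0 <= i < k) mu (F i)); first exact: H.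
apply/funext => k; rewrite sumeN// => i j _ _; exact: signed_adde_def.
Qed.

Lemma total_variationN : Defs.total_variation (fun A => - mu A) = Defs.total_variation mu.
Proof.
apply/funext => A; rewrite /Defs.total_variation; congr ereal_sup; apply/seteqP.
by split => x [n [F [mF [tF ->]]]]; exists n, F; split => //; split => //;
  apply: eq_bigr => i _; rewrite abseN.
Qed.

Lemma range_is_intervalN : range_is_interval mu -> range_is_interval (fun A => - mu A).
Proof.
move=> I x y z [A [mA Ax]] [B [mB By]] xz zy.
have [||||C [mC Cz]] := I (- y) (- x) (- z); rewrite ?leeN2//.
- by exists B; rewrite -By oppeK.
- by exists A; rewrite -Ax oppeK.
by exists C; rewrite Cz oppeK.
Qed.

Lemma condLN (nu : set T -> \bar R) : condL nu mu ->
  condL (fun A => - nu A) (fun A => - mu A).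
Proof.
move=> L A B mA mB /oppe_inj AB; rewrite !fin_numN => fA.
by have [-> ?] := L A B mA mB AB fA.
Qed.

End negation.

(** * Signed measures whose negative part is finite *)

Section variation.
Context {d : measure_display} {T : measurableType d} {R : realType}.
Variables (mu : set T -> \bar R) (P : set T).
Hypothesis smu : is_signed_measure mu.
Hypothesis mP : measurable P.
Local Open Scope ereal_scope.
Hypothesis posP : forall A, measurable A -> A `<=` P -> 0 <= mu A.
Hypothesis negP : forall A, measurable A -> A `<=` ~` P -> mu A <= 0.
Hypothesis finN : mu (~` P) \is a fin_num.

(** This is the total variation computed from a Hahn set; the absolute values keep it nonnegative on
    non-measurable sets as well. *)
Definition hahn_variation (Q A : set T) := `|mu (A `&` Q)| + `|mu (A `\` Q)|.
Let v := hahn_variation P.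

Let fN A : measurable A -> mu (A `\` P) \is a fin_num.
Proof.
move=> mA; apply: (signed_fin_sub smu _ _ _ finN); last by move=> x [].
  exact: measurableD.
exact: measurableC.
Qed.

Lemma hahn_variationE A : measurable A -> v A = mu (A `&` P) - mu (A `\` P).
Proof.
move=> mA; rewrite /v /hahn_variation gee0_abs ?lee0_abs//.
- by apply: negP; [exact: measurableD|move=> x []].
- by apply: posP; [exact: measurableI|move=> x []].
Qed.

Lemma hahn_variation0 : v set0 = 0.
Proof. by rewrite hahn_variationE// set0I set0D (signed0 smu) subee. Qed.

Lemma hahn_variation_ge0 A : 0 <= v A. Proof. exact: adde_ge0. Qed.

Lemma hahn_variation_sigma : semi_sigma_additive v.
Proof.
move=> F mF tF mUF; rewrite hahn_variationE//.
have H1 := signed_sigma smu (F := fun i => F i `&` P).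
have H2 := signed_sigma smu (F := fun i => F i `\` P).
rewrite setI_bigcupl setD_bigcupl.
have {}H1 : (fun k => \sum_(0 <= i < k) mu (F i `&` P)) @ \oo --> mu (\bigcup_i (F i `&` P)).
  by apply: H1 => [i|]; [exact: measurableI|exact: trivIset_setIr].
have {}H2 : (fun k => \sum_(0 <= i < k) mu (F i `\` P)) @ \oo --> mu (\bigcup_i (F i `\` P)).
  by apply: H2 => [i|]; [exact: measurableD|exact: trivIset_setIr].
(* Finiteness on the complement of [P] rules out a difference of two infinities. *)
have dfn : mu (\bigcup_i (F i `&` P)) +? - mu (\bigcup_i (F i `\` P)).
  by rewrite fin_num_adde_defl// fin_numN -setD_bigcupl; exact: fN.
have H := cvgeD dfn H1 (cvgeN H2).
rewrite (_ : (fun k => _) = ((fun k => \sum_(0 <= i < k) mu (F i `&` P)) \+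
  (fun k => - \sum_(0 <= i < k) mu (F i `\` P)))); first exact: H.
apply/funext => k /=.
rewrite -fin_num_sumeN; last by move=> i _; exact: fN.
by rewrite -big_split/=; apply: eq_bigr => i _; rewrite -hahn_variationE.
Qed.

Definition variation_measure : {measure set T -> \bar R} :=
  HB.pack_for (measure T R) v (isMeasure.Build d T R v
    hahn_variation0 hahn_variation_ge0 hahn_variation_sigma).
Let m := variation_measure.

Let mE A : measurable A -> m A = mu (A `&` P) - mu (A `\` P).
Proof. exact: hahn_variationE. Qed.

Lemma le_abs_variation A : measurable A -> `|mu A| <= m A.
Proof. by move=> mA; rewrite (signedID smu mA mP); exact: lee_abs_add. Qed.

(** Each [mu (F i)] is bounded by [m (F i)] in absolute value, and the two pieces cut out by [P]
    attain the bound. This identifies the atoms of [mu] with those of [m]. *)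
Lemma total_variation_hahn A : measurable A -> Defs.total_variation mu A = m A.
Proof.
move=> mA; apply/eqP; rewrite eq_le; apply/andP; split.
  apply: ge_ereal_sup => _ [n [F [mF [dF ->]]]].
  pose G i := if (i < n)%N then F i else set0.
  have mG i : measurable (G i) by rewrite /G; case: ifP => // _; case: (mF i).
  have tG : trivIset setT G.
    apply/trivIsetP => i j _ _ ij; rewrite /G; case: ifP; case: ifP; rewrite ?setI0 ?set0I//.
    by move=> jn iN; apply: dF => //; exact/eqP.
  apply: (@le_trans _ _ (\sum_(0 <= i < n) m (G i))).
    rewrite !big_mkord; apply: lee_sum => i _; rewrite /G ltn_ord.
    by apply: le_abs_variation; case: (mF i).
  rewrite big_mkord -(measure_bigsetU _ mG tG); apply: le_measure; rewrite ?inE//.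
    exact: bigsetU_measurable.
  rewrite -bigcup_mkord => x [i /= iN]; rewrite /G iN.
  by case: (mF i) => _; exact.
apply: ereal_sup_ubound.
exists 2%N, (fun i => if i == 0%N then A `&` P else A `\` P); split; [|split].
- by move=> i; case: eqP => _; split => //; [exact: measurableI|exact: measurableD].
- move=> [|[|i]] [|[|j]]//= _ _ _; [|rewrite setIC];
  by rewrite setDE setIACA setICr setI0.
- by rewrite !big_nat_recl//= big_nil adde0.
Qed.

(** The involution keeps [A] inside [P] and complements it outside; it turns [m] into [mu] up to a
    finite additive constant. *)
Let flip A := (A `&` P) `|` (~` P `\` A).

Let mflip A : measurable A -> measurable (flip A).
Proof. by move=> mA; apply: measurableU; [exact: measurableI|apply: measurableD => //; exact: measurableC]. Qed.

Let flipK A : flip (flip A) = A.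
Proof.
apply/seteqP; split => x; rewrite /flip /=.
  by move=> [[[[]|[]]//]|[nPx nfx]]; apply: contrapT => nAx; apply: nfx; right.
move=> Ax; have [Px|nPx] := pselect (P x); [left|right]; split => //; first by left.
by move=> [[]|[]].
Qed.

Let signed_flip (q : set T -> \bar R) A : is_signed_measure q -> measurable A ->
  q (flip A) = q (A `&` P) + q (~` P `\` A) /\ q (~` P) = q (A `\` P) + q (~` P `\` A).
Proof.
move=> sq mA; have mC : measurable (~` P) by exact: measurableC.
split.
  rewrite (signedU sq)//; [exact: measurableI|exact: measurableD|].
  by apply/seteqP; split => // x [[_ Px] [nPx _]].
by rewrite (signedID sq mC mA); congr (q _ + _); rewrite setDE setIC.
Qed.

Let m_flip A : measurable A -> m A = mu (flip A) - mu (~` P).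
Proof.
move=> mA; have [-> NE] := signed_flip smu mA; have := finN.
rewrite mE// NE fin_numD => /andP[f1 f2].
by rewrite fin_num_oppeD// [X in _ = _ + X]addeC addeA addeK.
Qed.

Variable nu : set T -> \bar R.
Hypothesis snu : is_signed_measure nu.
Hypothesis range_mu : range_is_interval mu.
Hypothesis L : condL nu mu.

Let nu_fin A : measurable A -> mu A \is a fin_num -> nu A \is a fin_num.
Proof. by move=> mA fA; case: (L mA mA erefl fA). Qed.

(** [P] is a Hahn set of [mu], not of [nu], so the value may be negative; the signs make it
    correspond to [nu] under [flip], as [m] does to [mu]. *)
Definition hahn_signed_part (A : set T) : R :=
  (fine (nu (A `&` P)) - fine (nu (A `\` P)))%R.
Let n := hahn_signed_part.

Let mfinP A : mfin m A -> mu (A `&` P) \is a fin_num.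
Proof.
move=> fA; have [mA _] := fA; have := mfin_fin_num fA.
by rewrite mE// fin_numD => /andP[].
Qed.

Let n_flip A : mfin m A -> n A = (fine (nu (flip A)) - fine (nu (~` P)))%R.
Proof.
move=> fA; have [mA _] := fA; have [-> ->] := signed_flip snu mA.
have mN : measurable (~` P) by exact: measurableC.
have f1 : nu (A `&` P) \is a fin_num by apply: nu_fin; [exact: measurableI|exact: mfinP].
have f2 : nu (A `\` P) \is a fin_num by apply: nu_fin; [exact: measurableD|exact: fN].
have f3 : nu (~` P `\` A) \is a fin_num.
  apply: nu_fin; first exact: measurableD.
  by apply: (signed_fin_sub smu) finN => //; exact: measurableD.
by rewrite !fineD// /n /hahn_signed_part; ring.
Qed.

Let n_sigma : fin_sigma_additive m n.
Proof.
move=> F mF tF fF.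
have mUF : measurable (\bigcup_i F i) by exact: bigcup_measurable.
have fU : mfin m (\bigcup_i F i) by [].
have H1 := signed_fine_sigma snu (F := fun i => F i `&` P).
have H2 := signed_fine_sigma snu (F := fun i => F i `\` P).
rewrite /n /hahn_signed_part setI_bigcupl setD_bigcupl.
have {}H1 : series (fun i => fine (nu (F i `&` P))) @ \oo --> fine (nu (\bigcup_i (F i `&` P))).
  apply: H1 => [i||]; [exact: measurableI|exact: trivIset_setIr|].
  by rewrite -setI_bigcupl; apply: nu_fin; [exact: measurableI|exact: mfinP].
have {}H2 : series (fun i => fine (nu (F i `\` P))) @ \oo --> fine (nu (\bigcup_i (F i `\` P))).
  apply: H2 => [i||]; [exact: measurableD|exact: trivIset_setIr|].
  by rewrite -setD_bigcupl; apply: nu_fin; [exact: measurableD|exact: fN].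
have H := cvgB H1 H2.
rewrite (_ : series _ = series (fun i => fine (nu (F i `&` P))) -
  series (fun i => fine (nu (F i `\` P))))%R; first exact: H.
by apply/funext => i; rewrite !fctE /series/= sumrB.
Qed.

Let flip_fin A : mfin m A -> mu (flip A) \is a fin_num.
Proof.
move=> fA; have [mA _] := fA; have := mfin_fin_num fA.
by rewrite m_flip// fin_numD => /andP[].
Qed.

(** Equal values of [m] mean equal values of [mu] on the flipped sets, where condition (L)
    applies. *)
Let n_mval A B : mfin m A -> mfin m B -> mval m A = mval m B -> n A = n B.
Proof.
move=> fA fB AB; have [mA _] := fA; have [mB _] := fB.
have : m A = m B by rewrite !mvalE// AB.
rewrite !m_flip// => /(congr1 (fun x => x + mu (~` P))); rewrite !subeK// => fAB.
have [E _] := L (mflip mA) (mflip mB) fAB (flip_fin fA).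
by rewrite !n_flip// E.
Qed.

(** The value [z] shifted by the [mu]-measure of the complement of [P] lies between two values of
    [mu]; flip a set that attains it. *)
Let range_m A (z : R) : mfin m A -> (0 <= z)%R -> (z <= mval m A)%R ->
  exists C, mfin m C /\ mval m C = z.
Proof.
move=> fA z0 zA; have [mA _] := fA.
have mN : measurable (~` P) by exact: measurableC.
have [||||C [mC Cz]] := range_mu (x := mu (~` P)) (y := mu (flip A)) (z := z%:E + mu (~` P)).
- by exists (~` P).
- by exists (flip A); split => //; exact: mflip.
- by rewrite leeDr// lee_fin.
- by rewrite -leeBrDr// -m_flip// mvalE// lee_fin.
have mCz : m (flip C) = z%:E by rewrite m_flip ?flipK ?Cz ?addeK//; exact: mflip.
exists (flip C); rewrite /mval mCz; split => //; split; first exact: mflip.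
by rewrite mCz ltry.
Qed.

(** The functions [n] and [m] agree with [nu] and [mu] inside [P] and with their negatives outside.
    The atom bound uses [|mu A|], which makes it invariant under change of sign. *)
Lemma hahn_linear : (exists eps M : R, (0 < eps)%R /\
    forall A, signed_atom mu A -> mu A \is a fin_num -> (`|fine (mu A)| < eps)%R ->
      (`|fine (nu A) / fine (mu A)| < M)%R) ->
  exists alpha : R, forall A, measurable A -> mu A \is a fin_num ->
    nu A = alpha%:E * mu A.
Proof.
move=> [eps [M [eps0 atomM]]].
have null A : measurable A -> mu A = 0 -> nu A = 0.
  move=> mA A0; have [|-> _] := L mA measurable0 (etrans A0 (esym (signed0 smu))).
    by rewrite A0.
  exact: signed0 snu.
have [|alpha lin] := positive_linear n_sigma n_mval range_m.
  exists eps, M; split => // A aA Ae.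
  have [fA A0 atA] := aA; have [mA _] := fA.
  have sA : signed_atom mu A.
    split => //; split.
      by rewrite total_variation_hahn// mvalE// lte_fin.
    move=> B mB BA; rewrite !total_variation_hahn// (mvalE (mfinS fA mB BA)) (mvalE fA).
    by have [->|->] := atA _ mB BA; [left|right].
  have mI : measurable (A `&` P) by exact: measurableI.
  have mD : measurable (A `\` P) by exact: measurableD.
  have fI : mu (A `&` P) \is a fin_num by exact: mfinP.
  have fD : mu (A `\` P) \is a fin_num by exact: fN.
  have vA : mval m A = (fine (mu (A `&` P)) - fine (mu (A `\` P)))%R.
    by rewrite /mval mE// fineB.
  have muA : fine (mu A) = (fine (mu (A `&` P)) + fine (mu (A `\` P)))%R.
    by rewrite (signedID smu mA mP) fineD.
  have nuA : fine (nu A) = (fine (nu (A `&` P)) + fine (nu (A `\` P)))%R.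
    by rewrite (signedID snu mA mP) fineD//; exact: nu_fin.
  have IP : mval m (A `&` P) = fine (mu (A `&` P)).
    rewrite /mval mE// -setIA setIid setDE -setIA setICr setI0 (signed0 smu).
    by rewrite sube0.
  (* An atom lies up to a null set in [P] or in its complement, and condition (L) makes [nu] vanish
     on the null part. *)
  have [nE muE] : (`|n A| = `|fine (nu A)| /\ `|fine (mu A)| = mval m A)%R.
    rewrite /n /hahn_signed_part nuA muA.
    have [I0|IA] := atA (A `&` P) mI (@subIsetl _ _ _).
      move: I0; rewrite IP => I0.
      rewrite I0 sub0r in vA; rewrite I0 add0r vA.
      have -> : nu (A `&` P) = 0 by apply: null => //; rewrite -(fineK fI) I0.
      rewrite sub0r add0r normrN; split => //.
      by rewrite -normrN ger0_norm// -vA mval_ge0.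
    move: IA; rewrite IP => IA.
    have D0 : fine (mu (A `\` P)) = 0%R by lra.
    rewrite D0 addr0.
    have -> : nu (A `\` P) = 0 by apply: null => //; rewrite -(fineK fD) D0.
    by rewrite subr0 addr0 IA; split => //; rewrite ger0_norm// ltW.
  have fmA : mu A \is a fin_num by rewrite (signedID smu mA mP) fin_numD fI.
  have := atomM A sA fmA; rewrite muE => /(_ Ae).
  rewrite normrM normfV muE -nE ltr_pdivrMr// => /ltW.
  exact.
have linP A : measurable A -> A `<=` P -> mu A \is a fin_num -> nu A = alpha%:E * mu A.
  move=> mA AP fA; have fmA : mfin m A.
    split => //; rewrite mE// (setIidl AP) setDE.
    have -> : A `&` ~` P = set0 by apply/seteqP; split => // x [/AP].
    by rewrite (signed0 smu) sube0 ltey_eq fA.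
  have := lin A fmA; rewrite /mval mE// /n /hahn_signed_part (setIidl AP) setDE.
  have -> : A `&` ~` P = set0 by apply/seteqP; split => // x [/AP].
  rewrite (signed0 smu) (signed0 snu) subr0 sube0 => E.
  by rewrite -(fineK (nu_fin mA fA)) E -{2}(fineK fA).
have linN A : measurable A -> A `<=` ~` P -> nu A = alpha%:E * mu A.
  move=> mA AP; have AN : A `\` P = A by rewrite setDE (setIidl AP).
  have AI : A `&` P = set0 by apply/seteqP; split => // x [/AP].
  have fA : mu A \is a fin_num by rewrite -AN; exact: fN.
  have fmA : mfin m A.
    by split => //; rewrite mE// AI AN (signed0 smu) sub0e ltey_eq fin_numN fA.
  have := lin A fmA; rewrite /mval mE// /n /hahn_signed_part AI AN.
  rewrite (signed0 smu) (signed0 snu) sub0r sub0e fineN => E.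
  rewrite -(fineK (nu_fin mA fA)) -(fineK fA) -EFinM; congr EFin; lra.
exists alpha => A mA fA.
have mI : measurable (A `&` P) by exact: measurableI.
have mD : measurable (A `\` P) by exact: measurableD.
have := fA; rewrite (signedID smu mA mP) fin_numD => /andP[fI fD].
rewrite (signedID snu mA mP) (linP _ mI (@subIsetr _ _ _) fI) (linN _ mD (@subDsetr _ _ _)).
by rewrite muleDr// fin_num_adde_defl.
Qed.

End variation.

(** * Partitions and Hahn decompositions in the sigma-finite case *)

Section sigma_finite.
Context {d : measure_display} {T : measurableType d} {R : realType}.
Local Open Scope ereal_scope.

Lemma sigma_finite_partition (mu : set T -> \bar R) : sigma_finite_signed mu ->
  exists D : nat -> set T, [/\ forall i, measurable (D i), trivIset setT D,
    \bigcup_i D i = setT &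
    forall i A, measurable A -> A `<=` D i -> mu A \is a fin_num].
Proof.
move=> [smu [F [finF UF]]].
have mF i : measurable (F i) by case: (finF i).
exists (seqDU F); split => [i||/=|i A mA AD].
- exact: seqDU_measurable.
- exact: trivIset_seqDU.
- by rewrite -seqDU_bigcup_eq.
rewrite fin_num_abs (le_lt_trans _ (proj2 (finF i)))//.
apply: ereal_sup_ubound; exists 1%N, (fun=> A); split; [|split].
- by move=> _; split => //; apply: subset_trans AD _; exact: subset_seqDU.
- by move=> [|i'] [|j].
- by rewrite big_nat1.
Qed.

(** On each piece of a partition with finite values [mu] is a finite charge with a Hahn
    decomposition; the positive sets of the pieces are glued together. *)
Lemma sigma_finite_hahn (mu : set T -> \bar R) : sigma_finite_signed mu ->
  exists P, [/\ measurable P, forall A, measurable A -> A `<=` P -> 0 <= mu A &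
    forall A, measurable A -> A `<=` ~` P -> mu A <= 0].
Proof.
move=> sfmu; have [smu _] := sfmu.
have [D [mD tD UD finD]] := sigma_finite_partition sfmu.
have hahn i : exists P, [/\ measurable P,
    forall A, measurable A -> A `<=` P -> 0 <= mu (A `&` D i) &
    forall A, measurable A -> A `<=` ~` P -> mu (A `&` D i) <= 0].
  pose c A := mu (A `&` D i).
  have c0 : c set0 = 0 by rewrite /c set0I (signed0 smu).
  have cfin A : measurable A -> c A \is a fin_num.
    by move=> mA; apply: (finD i); [exact: measurableI|exact: subIsetr].
  have csigma : semi_sigma_additive c.
    move=> F mF tF mUF; rewrite /c setI_bigcupl; apply: (signed_sigma smu).
    - by move=> j; exact: measurableI.
    - exact: trivIset_setIr.
  pose C : {charge set T -> \bar R} :=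
    HB.pack_for (charge T R) c (isCharge.Build d T R c c0 cfin csigma).
  have [P [N [[mP posP] [mN negN] PN PN0]]] := Hahn_decomposition C.
  exists P; split => // A mA AP; apply: negN => // x Ax.
  by have := I : setT x; rewrite -PN => -[/(AP x Ax)|].
have [P hP] := choice hahn.
pose Q := \bigcup_i (P i `&` D i).
have mQ : measurable Q.
  by apply: bigcup_measurable => i _; apply: measurableI => //; case: (hP i).
have disj i j x : D i x -> D j x -> i = j.
  by move=> Dix Djx; apply: tD => //; exists x.
have cover A : \bigcup_i (A `&` D i) = A by rewrite -setI_bigcupr UD setIT.
have sums A : measurable A -> (fun k => \sum_(0 <= i < k) mu (A `&` D i)) @ \oo --> mu A.
  move=> mA; rewrite -{2}(cover A); apply: (signed_sigma smu).
  - by move=> i; exact: measurableI.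
  - exact: trivIset_setIl.
exists Q; split => // A mA AQ; have H := sums A mA; rewrite -(cvg_lim _ H)//.
  apply: lime_ge; first by apply/cvg_ex; eexists; exact: H.
  apply: nearW => k; apply: sume_ge0 => i _; have [mPi pos _] := hP i.
  have -> : A `&` D i = (A `&` D i) `&` D i by rewrite -setIA setIid.
  apply: pos; first exact: measurableI.
  by move=> x [/AQ[j _ [Pjx Djx]] Dix]; rewrite (disj _ _ _ Dix Djx).
apply: lime_le; first by apply/cvg_ex; eexists; exact: H.
apply: nearW => k; apply: sume_le0 => i _; have [mPi _ neg] := hP i.
have -> : A `&` D i = (A `&` D i) `&` D i by rewrite -setIA setIid.
apply: neg; first exact: measurableI.
by move=> x [/AQ nQx Dix] Pix; apply: nQx; exists i.
Qed.

End sigma_finite.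

(** * Choice of sign and extension to sets of infinite measure *)

Unset Implicit Arguments.

Theorem theorem3p5 (d : measure_display) (T : measurableType d) (R : realType)
  (mu nu : set T -> \bar R) :
  sigma_finite_signed mu -> range_is_interval mu ->
  sigma_finite_signed nu -> condL nu mu ->
  (exists (eps M : R), 0 < eps /\
     forall A, signed_atom mu A -> (mu A < eps%:E)%E ->
       `| fine (nu A) / fine (mu A) | < M) ->
  exists alpha : R, forall A, measurable A -> nu A = (alpha%:E * mu A)%E.
Proof.
move=> sfmu I_mu [snu _] L [eps [M [eps0 atomM]]]; have [smu _] := sfmu.
have [P [mP pos neg]] := sigma_finite_hahn sfmu.
have [D [mD tD UD finD]] := sigma_finite_partition sfmu.
have [alpha lin] : exists alpha : R, forall A, measurable A -> mu A \is a fin_num ->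
    nu A = (alpha%:E * mu A)%E.
  have [fN|nfN] := boolP (mu (~` P) \is a fin_num).
    apply: (hahn_linear smu mP pos neg fN snu I_mu L).
    exists eps, M; split => // A aA fA Ae; apply: atomM => //.
    by rewrite -(fineK fA) lte_fin (le_lt_trans (ler_norm _)).
  have mC : measurable (~` P) by exact: measurableC.
  (* Only one infinite value can occur, so an infinite negative part forces [mu P] to be finite; the
     finite case then applies to the negated measures with complementary Hahn set. *)
  have fP : (- mu (~` (~` P)))%E \is a fin_num.
    rewrite setCK fin_numN; have := pos P mP (@subset_refl _ P).
    have := neg _ mC (@subset_refl _ _); move: nfN.
    case EN : (mu (~` P)) => [?||]//= _ _; case EP : (mu P) => [?||]//= _.
    by case: smu => _ [nmu _]; exfalso; apply: nmu; split; [exists P|exists (~` P)].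
  have posC A : measurable A -> A `<=` ~` P -> (0 <= - mu A)%E.
    by move=> mA AP; rewrite oppe_ge0; exact: neg.
  have negC A : measurable A -> A `<=` ~` ~` P -> (- mu A <= 0)%E.
    by rewrite setCK => mA AP; rewrite oppe_le0; exact: pos.
  have [|alpha lin] := hahn_linear (signed_measureN smu) mC posC negC fP
    (signed_measureN snu) (range_is_intervalN I_mu) (condLN L).
    exists eps, M; split => // A aA; rewrite fin_numN => fA Ae.
    have aA' : signed_atom mu A.
      by move: aA; rewrite /signed_atom total_variationN.
    move: Ae; rewrite !fineN normrN invrN mulrNN => Ae; apply: atomM => //.
    by rewrite -(fineK fA) lte_fin (le_lt_trans (ler_norm _)).
  exists alpha => A mA fA; have := lin A mA; rewrite fin_numN => /(_ fA).
  by rewrite muleN => /oppe_inj.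
exists alpha => A mA.
(* The identity holds on each piece, where [mu] is finite; countable additivity carries it to [A]
   even if [mu A] is infinite. *)
have mI i : measurable (A `&` D i) by exact: measurableI.
have tI : trivIset setT (fun i => A `&` D i) by exact: trivIset_setIl.
have UI : \bigcup_i (A `&` D i) = A by rewrite -setI_bigcupr UD setIT.
have fI i : mu (A `&` D i) \is a fin_num by apply: (finD i) => //; exact: subIsetr.
have := signed_sigma snu mI tI; rewrite UI => Hnu.
have := signed_sigma smu mI tI; rewrite UI => /(cvgeZl (y := alpha%:E) isT) Hmu.
apply: (cvg_unique (@ereal_hausdorff R) Hnu); apply: cvg_trans Hmu.
apply: near_eq_cvg; apply: nearW => k.
rewrite fin_num_sume_distrr//; last by move=> i j _ _; exact: fin_num_adde_defl.
by apply: eq_bigr => i _; rewrite lin.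
Qed.
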